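(* Let $U\subset X$ be quasiopen and $u:U\to[-\infty,\infty]$. Then $u\in N^{1,p}(U)$ if and only if $u\in L^p(U)$ and $u$ has a $p$-fine upper gradient $\hat g_u\in L^p(U)$. Moreover, in this case $\hat g_u=g_{u,U}$ a.e. in $U$.
   Context: Standing assumptions: $1<p<\infty$; $X=(X,d,\mu)$ is a complete metric space with a positive complete Borel measure $\mu$, $0<\mu(B)<\infty$ for all balls; $\mu$ is doubling; $X$ supports a $p$-Poincaré inequality (there are $C>0,\lambda\ge1$ with $\frac1{\mu(B)}\int_B|f-f_B|\,d\mu\le C\,\mathrm{diam}(B)(\frac1{\mu(\lambda B)}\int_{\lambda B}g^p\,d\mu)^{1/p}$ for all balls $B$, integrable $f$ and upper gradients $g$ of $f$). Measurable $E\subset X$ is regarded as a metric measure space with restricted metric and measure. For $f:E\to[-\infty,\infty]$, a Borel $g:E\to[0,\infty]$ is an upper gradient of $f$ in $E$ if $|f(\gamma(0))-f(\gamma(l_\gamma))|\le\int_\gamma g\,ds$ for all nonconstant compact rectifiable arc-length parametrized curves in $E$ (left side $\infty$ if either value is infinite). A measurable $g\ge0$ is a $p$-weak upper gradient if this holds for all curves in $E$ outside a family of zero $p$-modulus ($\mathrm{Mod}_p(\Gamma)=\inf\int\rho^p\,d\mu$ over Borel $\rho\ge0$ with $\int_\gamma\rho\,ds\ge1$ on $\Gamma$). $N^{1,p}(E)$: everywhere defined measurable $f:E\to[-\infty,\infty]$ with $\int_E|f|^p\,d\mu+\inf_g\int_Eg^p\,d\mu<\infty$ (infimum over upper gradients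 in $E$); $D^p(E)$: measurable $f$ on $E$ with an upper gradient in $L^p(E)$. For $f$ with an upper gradient in $L^p_{loc}(E)$, $g_{f,E}$ denotes its minimal $p$-weak upper gradient in $E$ (unique a.e.). $C_p(E)=\inf\|v\|^p_{N^{1,p}(X)}$ over $v\in N^{1,p}(X)$, $v\ge1$ on $E$. Quasiopen: for every $\varepsilon>0$ there is open $G$ with $C_p(G)<\varepsilon$ and $U\cup G$ open. A quasicovering of $U$ is a countable family $\mathcal B$ of quasiopen sets with $\bigcup\mathcal B\subset U$, $C_p(U\setminus\bigcup\mathcal B)=0$. A function $\hat g_u:U\to[0,\infty]$ is a $p$-fine upper gradient of $u$ if there is a quasicovering $\mathcal B$ of $U$ such that $u\in D^p(V)$ and $\hat g_u=g_{u,V}$ a.e. in $V$ for every $V\in\mathcal B$. *)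

(* Defs.v *)
From HB Require Import structures.
From mathcomp Require Import all_boot all_order all_algebra.
From mathcomp Require Import all_classical all_reals all_analysis measurable_realfun.
Set Implicit Arguments. Unset Strict Implicit. Unset Printing Implicit Defensive.
Import Order.TTheory GRing.Theory Num.Theory.
Import numFieldNormedType.Exports.
Local Open Scope classical_set_scope.
Local Open Scope ring_scope.

Definition is_metric {R : realType} {T : Type} (dist : T -> T -> R) : Prop :=
  (forall x y, 0 <= dist x y) /\
  (forall x y, dist x y = 0 <-> x = y) /\
  (forall x y, dist x y = dist y x) /\
  (forall x y z, dist x z <= dist x y + dist y z).

Definition dball {R : realType} {T : Type} (dist : T -> T -> R) (x : T) (r : R)
  : set T := [set y | dist x y < r].

Definition dopen {R : realType} {T : Type} (dist : T -> T -> R) (A : set T) : Prop :=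
  forall x, A x -> exists2 r : R, 0 < r & dball dist x r `<=` A.

Definition dcomplete {R : realType} {T : Type} (dist : T -> T -> R) : Prop :=
  forall u : nat -> T,
    (forall e : R, 0 < e -> exists N : nat, forall m n, (N <= m)%N -> (N <= n)%N ->
        dist (u m) (u n) < e) ->
    exists x : T, forall e : R, 0 < e -> exists N : nat, forall n, (N <= n)%N ->
        dist (u n) x < e.

Definition dborel {R : realType} {T : Type} (dist : T -> T -> R) : set (set T) :=
  <<s [set A | dopen dist A] >>.

Definition ddiam {R : realType} {T : Type} (dist : T -> T -> R) (A : set T) : \bar R :=
  ereal_sup [set (dist x y)%:E | x in A & y in A].

(* mu is a positive complete Borel measure: the sigma-algebra of T is exactly
   the mu-completion of the Borel sigma-algebra, and mu is complete. *)
Definition complete_borel_measure {R : realType} {d : measure_display}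
  {T : measurableType d} (dist : T -> T -> R) (mu : {measure set T -> \bar R}) : Prop :=
  (forall A, dborel dist A -> measurable A) /\
  (forall N, measurable N -> mu N = 0%E -> forall A, A `<=` N -> measurable A) /\
  (forall A, measurable A -> exists B N, dborel dist B /\ dborel dist N /\
       mu N = 0%E /\ ((A `\` B) `|` (B `\` A)) `<=` N).

Definition balls_pos_finite {R : realType} {d : measure_display}
  {T : measurableType d} (dist : T -> T -> R) (mu : {measure set T -> \bar R}) : Prop :=
  forall x r, 0 < r -> (0 < mu (dball dist x r))%E /\ (mu (dball dist x r) < +oo)%E.

Definition doubling {R : realType} {d : measure_display}
  {T : measurableType d} (dist : T -> T -> R) (mu : {measure set T -> \bar R}) : Prop :=
  exists C : R, forall x r, 0 < r ->
    (mu (dball dist x (2 * r)) <= C%:E * mu (dball dist x r))%E.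

(* A curve is a pair (gamma, l): gamma restricted to [0, l]. *)
Definition curve (R : realType) (T : Type) := ((R -> T) * R)%type.

Definition dlength {R : realType} {T : Type} (dist : T -> T -> R)
  (gamma : R -> T) (a b : R) : \bar R :=
  ereal_sup [set z | exists (n : nat) (s : nat -> R),
      [/\ s 0%N = a, s n = b, (forall i, (i < n)%N -> s i <= s i.+1) &
           z = (\sum_(i < n) dist (gamma (s i)) (gamma (s i.+1)))%:E]].

(* a nonconstant compact rectifiable arc-length parametrized curve in E *)
Definition curve_in {R : realType} {T : Type} (dist : T -> T -> R)
  (E : set T) (c : curve R T) : Prop :=
  0 < c.2 /\
  (forall s t, 0 <= s -> s <= t -> t <= c.2 -> dlength dist c.1 s t = (t - s)%:E) /\
  (forall t, 0 <= t -> t <= c.2 -> E (c.1 t)).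

Definition line_int {R : realType} {T : Type} (g : T -> \bar R) (c : curve R T)
  : \bar R :=
  (\int[@lebesgue_measure R]_(t in `[0%R, c.2]%classic) g (c.1 t))%E.

Definition borel_on {R : realType} {T : Type} (dist : T -> T -> R)
  (E : set T) (g : T -> \bar R) : Prop :=
  forall B : set (\bar R), measurable B ->
    exists2 A, dborel dist A & E `&` (g @^-1` B) = E `&` A.

Definition nonneg_on {R : realType} {T : Type} (E : set T) (g : T -> \bar R) : Prop :=
  forall x, E x -> (0 <= g x)%E.

Definition ug_lhs {R : realType} (a b : \bar R) : \bar R :=
  if (a \is a fin_num) && (b \is a fin_num) then `|(a - b)%E|%E else +oo%E.

Definition ug_ineq {R : realType} {T : Type} (f g : T -> \bar R) (c : curve R T) : Prop :=
  (ug_lhs (f (c.1 0%R)) (f (c.1 c.2)) <= line_int g c)%E.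

Definition upper_gradient {R : realType} {T : Type} (dist : T -> T -> R)
  (E : set T) (f g : T -> \bar R) : Prop :=
  borel_on dist E g /\ nonneg_on E g /\
  forall c, curve_in dist E c -> ug_ineq f g c.

Definition pmodulus {R : realType} {d : measure_display} {T : measurableType d}
  (dist : T -> T -> R) (mu : {measure set T -> \bar R}) (p : R)
  (E : set T) (G : set (curve R T)) : \bar R :=
  ereal_inf [set (\int[mu]_(x in E) poweR (rho x) p)%E
            | rho in [set rho : T -> \bar R | borel_on dist E rho /\ nonneg_on E rho /\
                      forall c, G c -> (1 <= line_int rho c)%E]].

Definition pweak_ug {R : realType} {d : measure_display} {T : measurableType d}
  (dist : T -> T -> R) (mu : {measure set T -> \bar R}) (p : R)
  (E : set T) (f g : T -> \bar R) : Prop :=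
  measurable_fun E g /\ nonneg_on E g /\
  exists G : set (curve R T),
    G `<=` curve_in dist E /\ pmodulus dist mu p E G = 0%E /\
    forall c, curve_in dist E c -> ~ G c -> ug_ineq f g c.

Definition Lp_on {R : realType} {d : measure_display} {T : measurableType d}
  (mu : {measure set T -> \bar R}) (p : R) (E : set T) (f : T -> \bar R) : Prop :=
  measurable_fun E f /\ (\int[mu]_(x in E) poweR `|f x|%E p < +oo)%E.

Definition N1p_energy {R : realType} {d : measure_display} {T : measurableType d}
  (dist : T -> T -> R) (mu : {measure set T -> \bar R}) (p : R)
  (E : set T) (f : T -> \bar R) : \bar R :=
  ((\int[mu]_(x in E) poweR `|f x|%E p) +
   ereal_inf [set (\int[mu]_(x in E) poweR (g x) p)%E
             | g in upper_gradient dist E f])%E.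

Definition N1p {R : realType} {d : measure_display} {T : measurableType d}
  (dist : T -> T -> R) (mu : {measure set T -> \bar R}) (p : R)
  (E : set T) (f : T -> \bar R) : Prop :=
  measurable_fun E f /\ (N1p_energy dist mu p E f < +oo)%E.

Definition Dp {R : realType} {d : measure_display} {T : measurableType d}
  (dist : T -> T -> R) (mu : {measure set T -> \bar R}) (p : R)
  (E : set T) (f : T -> \bar R) : Prop :=
  measurable_fun E f /\
  exists2 g, upper_gradient dist E f g & (\int[mu]_(x in E) poweR (g x) p < +oo)%E.

Definition min_pweak_ug {R : realType} {d : measure_display} {T : measurableType d}
  (dist : T -> T -> R) (mu : {measure set T -> \bar R}) (p : R)
  (E : set T) (f g : T -> \bar R) : Prop :=
  pweak_ug dist mu p E f g /\ Lp_on mu p E g /\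
  forall h, pweak_ug dist mu p E f h -> Lp_on mu p E h ->
    {ae mu, forall x, E x -> (g x <= h x)%E}.

Definition Cp {R : realType} {d : measure_display} {T : measurableType d}
  (dist : T -> T -> R) (mu : {measure set T -> \bar R}) (p : R) (E : set T) : \bar R :=
  ereal_inf [set N1p_energy dist mu p setT v
            | v in [set v : T -> \bar R | N1p dist mu p setT v /\
                      forall x, E x -> (1 <= v x)%E]].

Definition quasiopen {R : realType} {d : measure_display} {T : measurableType d}
  (dist : T -> T -> R) (mu : {measure set T -> \bar R}) (p : R) (U : set T) : Prop :=
  forall eps : R, 0 < eps -> exists G : set T,
    [/\ dopen dist G, (Cp dist mu p G < eps%:E)%E & dopen dist (U `|` G)].

Definition quasicovering {R : realType} {d : measure_display} {T : measurableType d}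
  (dist : T -> T -> R) (mu : {measure set T -> \bar R}) (p : R)
  (U : set T) (B : set (set T)) : Prop :=
  [/\ countable B, (forall V, B V -> quasiopen dist mu p V),
      (\bigcup_(V in B) V `<=` U) &
      Cp dist mu p (U `\` (\bigcup_(V in B) V)) = 0%E].

Definition pfine_ug {R : realType} {d : measure_display} {T : measurableType d}
  (dist : T -> T -> R) (mu : {measure set T -> \bar R}) (p : R)
  (U : set T) (u hg : T -> \bar R) : Prop :=
  nonneg_on U hg /\
  exists B : set (set T), quasicovering dist mu p U B /\
    forall V, B V -> Dp dist mu p V u /\
      exists g, min_pweak_ug dist mu p V u g /\ {ae mu, forall x, V x -> hg x = g x}.

Definition avg {R : realType} {d : measure_display} {T : measurableType d}
  (mu : {measure set T -> \bar R}) (E : set T) (h : T -> \bar R) : \bar R :=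
  ((fine (mu E))^-1%:E * \int[mu]_(x in E) h x)%E.

Definition poincare {R : realType} {d : measure_display} {T : measurableType d}
  (dist : T -> T -> R) (mu : {measure set T -> \bar R}) (p : R) : Prop :=
  exists C lam : R, 0 < C /\ 1 <= lam /\
    forall (x : T) (r : R) (f : T -> R) (g : T -> \bar R), 0 < r ->
      mu.-integrable setT (EFin \o f) ->
      upper_gradient dist setT (EFin \o f) g ->
      let B := dball dist x r in
      let fB := fine (avg mu B (EFin \o f)) in
      (avg mu B (fun y => `|f y - fB|%:E) <=
        C%:E * ddiam dist B *
        poweR (avg mu (dball dist x (lam * r)) (fun y => poweR (g y) p)) p^-1)%E.

Definition standing {R : realType} {d : measure_display} {T : measurableType d}
  (dist : T -> T -> R) (mu : {measure set T -> \bar R}) (p : R) : Prop :=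
  [/\ 1 < p, is_metric dist, dcomplete dist, complete_borel_measure dist mu &
      [/\ balls_pos_finite dist mu, doubling dist mu & poincare dist mu p]].

(* Main.v *)
(** Everything is done along curves. For p-almost every curve, meaning that a fixed
    p-integrable Borel function has finite integral along it, the following holds.
    If C_p(G_n) tends to 0 fast enough, the curve avoids some G_n altogether: the
    test functions of G_n have small integral and small oscillation along the curve,
    so they cannot reach 1. Hence preimages of quasiopen sets under the curve are
    relatively open, and sets of zero capacity are avoided. Given a quasicovering,
    the preimages of its members therefore form an open cover of the parameter
    interval, and the upper gradient inequality, valid on short subcurves, adds up
    to the whole curve. Minimal p-weak upper gradients are obtained from a sequence
    that minimizes the energy; it can be taken decreasing because the minimum of two
    p-weak upper gradients is one. The neglect of null sets and the passage from
    measurable to Borel functions use that mu is the completion of a Borel measure. *)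

Require Import Defs.
From HB Require Import structures.
From mathcomp Require Import all_boot all_order all_algebra.
From mathcomp Require Import all_classical all_reals all_analysis measurable_realfun ring lra.
Set Implicit Arguments. Unset Strict Implicit. Unset Printing Implicit Defensive.
Import Order.TTheory GRing.Theory Num.Theory.
Import numFieldNormedType.Exports.
Local Open Scope classical_set_scope.
Local Open Scope ring_scope.

(** * Extended triangle inequality and integrals on the real line *)

Lemma invr_bound_lt {R : realType} (e : R) : 0 < e -> (Num.bound e^-1).+1%:R^-1 < e.
Proof.
move=> e0; rewrite -[ltRHS]invrK ltf_pV2 ?posrE ?invr_gt0//.
apply: lt_trans (archi_boundP _) _; first by rewrite invr_ge0 ltW.
by rewrite ltr_nat.
Qed.

(** An infinite value at any of the three points makes a summand on the right infinite; finite
    values obey the usual triangle inequality. *)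
Lemma ug_lhs_triangle {R : realType} (a b c : \bar R) :
  (ug_lhs a c <= ug_lhs a b + ug_lhs b c)%E.
Proof.
have lhs0 x y : (0 <= @ug_lhs R x y)%E by rewrite /ug_lhs; case: ifP.
have [/andP[fa fb]|nab] := boolP ((a \is a fin_num) && (b \is a fin_num)); last first.
  by rewrite {2}/ug_lhs (negbTE nab) addye ?leey// -ltNye (lt_le_trans _ (lhs0 _ _)).
have [fc|nc] := boolP (c \is a fin_num); last first.
  rewrite {3}/ug_lhs (negbTE nc) andbF addey ?leey// -ltNye.
  exact: lt_le_trans (lhs0 _ _).
rewrite /ug_lhs fa fb fc/=.
move: a b c fa fb fc => [a| |] [b| |] [c| |]//= _ _ _.
by rewrite lee_fin; exact: ler_distD.
Qed.

(** Dominated convergence, phrased for lower bounds of integrals; it serves mixtures over increasing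
    unions and decreasing sequences of gradients. *)
Lemma le_integral_dominated_lim {R : realType} {d : measure_display}
  {T : measurableType d} (mu : {measure set T -> \bar R}) (D : set T)
  (f_ : nat -> T -> \bar R) (f dom : T -> \bar R) (x : \bar R) :
  measurable D -> (forall n, measurable_fun D (f_ n)) -> measurable_fun D dom ->
  (forall n t, D t -> (0 <= f_ n t)%E /\ (f_ n t <= dom t)%E) ->
  (\int[mu]_(t in D) dom t < +oo)%E ->
  (forall t, D t -> f_ ^~ t @ \oo --> f t) ->
  (forall n, (x <= \int[mu]_(t in D) f_ n t)%E) ->
  (x <= \int[mu]_(t in D) f t)%E.
Proof.
move=> mD mf mdom fdom domoo ff xf.
have dom0 t : D t -> (0 <= dom t)%E.
  by move=> Dt; have [] := fdom 0%N t Dt; exact: le_trans.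
have idom : mu.-integrable D dom.
  apply/integrableP; split => //; under eq_integral => t Dt.
    rewrite gee0_abs; last by apply: dom0; rewrite inE in Dt.
    over.
  by [].
have mlim : measurable_fun D f by exact: emeasurable_fun_cvg ff.
have [_ _ cv] := dominated_convergence mD mf mlim (aeW mu ff) idom
  (aeW mu (fun t n Dt => (let: conj f0 fd := fdom n t Dt in
     eq_ind_r (fun y => y <= dom t)%E fd (gee0_abs f0)))).
rewrite -(cvg_lim _ cv)//; apply: lime_ge; first by apply/cvg_ex; eexists; exact: cv.
by apply: nearW.
Qed.

(** The push-forward of Lebesgue measure under a translation gives half-open intervals their length,
    so by uniqueness it is Lebesgue measure. *)
Lemma integral_itvcc_translate {R : realType} (f : R -> \bar R) (a b : R) :
  measurable_fun setT f -> (forall t, 0 <= f t)%E ->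
  (\int[lebesgue_measure]_(t in `[a, b]) f t =
   \int[lebesgue_measure]_(t in `[0%R, (b - a)%R]) f (a + t)%R)%E.
Proof.
move=> mf f0.
pose M := measurableTypeR R.
have mphi : measurable_fun [set: M] (fun t : M => (a + t)%R : M).
  by apply: measurable_funD => //; exact: measurable_cst.
pose Hm := isMeasurableFun.Build _ _ _ _ _ mphi.
pose phi : {mfun M >-> M} := HB.pack (fun t : M => (a + t)%R : M) Hm.
have leb (A : set M) : measurable A ->
    (@lebesgue_measure R A = pushforward (@lebesgue_measure R) phi A)%E.
  apply: (@lebesgue_measure_unique R (pushforward lebesgue_measure phi)).
  move=> _ [[x y] _ <-]; rewrite /pushforward /=.
  transitivity (lebesgue_measure `](x - a)%R, (y - a)%R]%classic); last first.
    congr (lebesgue_measure _); apply/seteqP; split => t /=;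
      by rewrite !in_itv/= => /andP[? ?]; apply/andP; split; lra.
  rewrite !lebesgue_measure_itv/= !lte_fin ltrD2r; case: ifP => // _.
  by rewrite -!EFinB; congr (_%:E); ring.
transitivity (\int[pushforward lebesgue_measure phi]_(t in `[a, b]) f t)%E.
  by apply: eq_measure_integral => A mA _; exact: leb.
rewrite ge0_integral_pushforward//; last exact: measurable_funTS.
have -> : phi @^-1` `[a, b] = `[0, b - a]%classic.
  by apply/seteqP; split => t /=; rewrite !in_itv/= => /andP[? ?]; apply/andP; split; lra.
by [].
Qed.

(** * Upper gradients of functions of one real variable *)

(** All subintervals are included, since mixing two gradients cuts the interval into pieces. *)
Definition ug_along {R : realType} (h phi : R -> \bar R) (a b : R) : Prop :=
  forall s t, a <= s -> s < t -> t <= b ->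
  (ug_lhs (h s) (h t) <= \int[lebesgue_measure]_(r in `[s, t]) phi r)%E.

Lemma ge0_integral_itvcc_split {R : realType} (phi : R -> \bar R) (a b c : R) :
  measurable_fun setT phi -> (forall t, 0 <= phi t)%E -> a <= b -> b <= c ->
  (\int[lebesgue_measure]_(t in `[a, c]) phi t =
   \int[lebesgue_measure]_(t in `[a, b]) phi t +
   \int[lebesgue_measure]_(t in `[b, c]) phi t)%E.
Proof.
move=> mphi phi0 ab bc.
have -> : `[a, c]%classic = `[a, b]%classic `|` `]b, c]%classic.
  by rewrite -itv_bndbnd_setU// bnd_simp.
rewrite ge0_integral_setU//=; last 2 first.
- exact: measurable_funTS.
- apply/disj_setPS => t /=; rewrite !in_itv/= => -[/andP[_ tb] /andP[bt _]].
  by move: (lt_le_trans bt tb); rewrite ltxx.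
by rewrite integral_itv_obnd_cbnd//; exact: measurable_funTS.
Qed.

Lemma ug_lhs_chain {R : realType} (h phi : R -> \bar R) (a b c : R) :
  measurable_fun setT phi -> (forall t, 0 <= phi t)%E -> a <= b -> b <= c ->
  (ug_lhs (h a) (h b) <= \int[lebesgue_measure]_(r in `[a, b]) phi r)%E ->
  (ug_lhs (h b) (h c) <= \int[lebesgue_measure]_(r in `[b, c]) phi r)%E ->
  (ug_lhs (h a) (h c) <= \int[lebesgue_measure]_(r in `[a, c]) phi r)%E.
Proof.
move=> mphi phi0 ab bc hab hbc; apply: le_trans (ug_lhs_triangle _ (h b) _) _.
by rewrite (ge0_integral_itvcc_split mphi phi0 ab bc); exact: leeD.
Qed.

Definition mix {T U : Type} (A : set T) (f g : T -> U) (t : T) : U :=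
  if t \in A then f t else g t.

Lemma measurable_mix {d d'} {T : measurableType d} {U : measurableType d'}
  (A : set T) (f g : T -> U) :
  measurable A -> measurable_fun setT f -> measurable_fun setT g ->
  measurable_fun setT (mix A f g).
Proof.
move=> mA mf mg; apply: measurable_fun_ifT => //.
apply: (measurable_fun_bool true); rewrite setTI.
by rewrite [X in measurable X](_ : _ = A)//; apply/seteqP; split => t /= At;
  [exact: set_mem|exact: mem_set].
Qed.

(* The sets A for which all such mixtures work form a sigma-algebra, and it contains the
   half-lines because the interval can be split at their endpoint. No differentiation
   of h is needed. *)
Lemma ug_along_mix {R : realType} (h phi psi : R -> \bar R) (a b : R) (A : set R) :
  measurable_fun setT phi -> measurable_fun setT psi ->
  (forall t, 0 <= phi t)%E -> (forall t, 0 <= psi t)%E ->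
  (\int[lebesgue_measure]_(r in `[a, b]) phi r < +oo)%E ->
  (\int[lebesgue_measure]_(r in `[a, b]) psi r < +oo)%E ->
  ug_along h phi a b -> ug_along h psi a b ->
  measurable A -> ug_along h (mix A phi psi) a b.
Proof.
move=> mphi mpsi phi0 psi0 iphi ipsi uphi upsi mA.
pose good (phi : R -> \bar R) := [/\ measurable_fun setT phi, (forall t, 0 <= phi t)%E,
  (\int[lebesgue_measure]_(r in `[a, b]) phi r < +oo)%E & ug_along h phi a b].
(* Quantifying over all good pairs allows mixtures to be iterated, which gives intersections through
   [mixI]. *)
pose C : set (set R) := [set A | measurable A /\
  forall phi psi, good phi -> good psi -> good (mix A phi psi)].
have mixI A1 A2 (f g : R -> \bar R) : mix A1 (mix A2 f g) g = mix (A1 `&` A2) f g.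
  apply/funext => t; rewrite /mix in_setI.
  by case: (t \in A1); case: (t \in A2).
have mixC A1 (f g : R -> \bar R) : mix (~` A1) f g = mix A1 g f.
  by apply/funext => t; rewrite /mix in_setC; case: (t \in A1).
have mix_ge0 A1 (f g : R -> \bar R) : (forall t, 0 <= f t)%E -> (forall t, 0 <= g t)%E ->
    (forall t, 0 <= mix A1 f g t)%E by move=> f0 g0 t; rewrite /mix; case: ifP.
have mix_int A1 f g : measurable A1 -> good f -> good g ->
    (\int[lebesgue_measure]_(r in `[a, b]) mix A1 f g r < +oo)%E.
  move=> mA1 [mf f0 fi _] [mg g0 gi _].
  apply: (@le_lt_trans _ _ (\int[lebesgue_measure]_(r in `[a, b]) (f r + g r))%E).
    apply: ge0_le_integral => //=.
    - by move=> t _; exact: mix_ge0.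
    - by apply: measurable_funTS; exact: measurable_mix.
    - by apply: measurable_funTS; exact: emeasurable_funD.
    - by move=> t _; rewrite /mix; case: ifP => _; [exact: leeDl|exact: leeDr].
  rewrite ge0_integralD//; [exact: lte_add_pinfty| |]; exact: measurable_funTS.
have CC A1 : C A1 -> C (~` A1).
  move=> [mA1 C1]; split; first exact: measurableC.
  by move=> f g gf gg; rewrite mixC; exact: C1.
have CI A1 A2 : C A1 -> C A2 -> C (A1 `&` A2).
  move=> [mA1 C1] [mA2 C2]; split; first exact: measurableI.
  by move=> f g gf gg; rewrite -mixI; apply: C1 => //; exact: C2.
have C0 : C set0.
  split; first exact: measurable0.
  move=> f g gf gg; suff -> : mix set0 f g = g by [].
  by apply/funext => t; rewrite /mix in_set0.
have CU A1 A2 : C A1 -> C A2 -> C (A1 `|` A2).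
  by move=> c1 c2; rewrite -(setCK (_ `|` _)) setCU; apply: (CC); apply: CI; exact: CC.
have Cbig (F : nat -> set R) : (forall n, C (F n)) -> C (\bigcup_n F n).
  move=> CF; have mF : measurable (\bigcup_n F n).
    by apply: bigcupT_measurable => n; case: (CF n).
  split => // f g gf gg.
  have [mf f0 fi fu] := gf; have [mg g0 gi gu] := gg.
  split; [exact: measurable_mix|exact: mix_ge0|exact: mix_int|].
  (* Partial unions: at each point their mixtures eventually equal that of the full union, and
     [f + g] is an integrable majorant. *)
  pose B n := \big[setU/set0]_(k < n) F k.
  have CB n : C (B n).
    rewrite /B; elim: n => [|n IH]; first by rewrite big_ord0.
    by rewrite big_ord_recr/=; exact: CU.
  move=> s t as_ st tb.
  have sub : `[s, t]%classic `<=` `[a, b]%classic.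
    move=> x /=; rewrite !in_itv/= => /andP[sx xt].
    by rewrite (le_trans as_ sx) (le_trans xt tb).
  apply: (@le_integral_dominated_lim R _ (measurableTypeR R) lebesgue_measure _
    (fun n => mix (B n) f g) _
    (fun r => f r + g r)%E) => //.
  - by move=> n; apply: measurable_funTS; have [mB _] := CB n; exact: measurable_mix.
  - by apply: measurable_funTS; exact: emeasurable_funD.
  - move=> n r _; split; first exact: mix_ge0.
    by rewrite /mix; case: ifP => _; [exact: leeDl|exact: leeDr].
  - apply: (@le_lt_trans _ _ (\int[lebesgue_measure]_(r in `[a, b]) (f r + g r))%E).
      apply: ge0_subset_integral => //.
      + by apply: measurable_funTS; exact: emeasurable_funD.
      + by move=> r _; exact: adde_ge0.
    rewrite ge0_integralD//; [exact: lte_add_pinfty| |]; exact: measurable_funTS.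
  - move=> r _; apply: cvg_near_cst.
    have [[k _ Fk]|nF] := pselect ((\bigcup_n F n) r).
      exists k.+1 => // m /= km; rewrite /mix !mem_set//; first by exists k.
      by rewrite /B -bigcup_mkord; exists k.
    exists 0%N => // m /= _; rewrite /mix !memNset//.
    by rewrite /B -bigcup_mkord => -[k _ Fk]; apply: nF; exists k.
  - by move=> n; have [_ /(_ f g gf gg)[_ _ _]] := CB n; apply.
have Cray x : C `[x, +oo[%classic.
  split; first exact: measurable_itv.
  move=> f g gf gg; have [mf f0 fi fu] := gf; have [mg g0 gi gu] := gg.
  split; [exact: measurable_mix|exact: mix_ge0|exact: mix_int|].
  move=> s t as_ st tb.
  have mixl s' t' : x <= s' ->
      (\int[lebesgue_measure]_(r in `[s', t']) mix `[x, +oo[%classic f g r =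
      \int[lebesgue_measure]_(r in `[s', t']) f r)%E.
    move=> xs; apply: eq_integral => r; rewrite inE/= in_itv/= => /andP[sr _].
    by rewrite /mix mem_set//= in_itv/= (le_trans xs sr).
  have mixr s' t' : t' <= x ->
      (\int[lebesgue_measure]_(r in `[s', t']) mix `[x, +oo[%classic f g r =
      \int[lebesgue_measure]_(r in `[s', t']) g r)%E.
    (* If [t' = x], the mixture takes the value of [f] at the right endpoint, so that endpoint is
       dropped before comparing with [g]. *)
    move=> xs; rewrite -!integral_itv_bndo_bndc.
    - apply: eq_integral => r; rewrite inE/= in_itv/= => /andP[_ rt].
      by rewrite /mix memNset//= in_itv/= andbT leNgt (lt_le_trans rt xs).
    - exact: measurable_funTS.
    - by apply: measurable_funTS; exact: measurable_mix.
  have [xs|sx] := leP x s; first by rewrite mixl//; exact: fu.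
  have [tx|xt] := leP t x; first by rewrite mixr//; exact: gu.
  apply: (@ug_lhs_chain _ _ _ s x t) => //.
  - exact: measurable_mix.
  - exact: mix_ge0.
  - exact: ltW.
  - exact: ltW.
  - by rewrite mixr//; apply: gu => //; exact: le_trans (ltW xt) tb.
  - by rewrite mixl//; apply: fu => //; exact: le_trans as_ (ltW sx).
suff CA : C A by have [_ /(_ phi psi)[]] := CA.
have : <<s @RGenCInfty.G R >> A.
  by rewrite -[X in X A]/((@RGenCInfty.G R).-sigma.-measurable) -RGenCInfty.measurableE.
apply: smallest_sub; last by move=> _ [x ->]; exact: Cray.
by split => //; move=> A1 c1; rewrite setTD; exact: CC.
Qed.

(** The minimum is the mixture over the set where [phi < psi]. *)
Lemma ug_along_min {R : realType} (h phi psi : R -> \bar R) (a b : R) :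
  measurable_fun setT phi -> measurable_fun setT psi ->
  (forall t, 0 <= phi t)%E -> (forall t, 0 <= psi t)%E ->
  (\int[lebesgue_measure]_(r in `[a, b]) phi r < +oo)%E ->
  (\int[lebesgue_measure]_(r in `[a, b]) psi r < +oo)%E ->
  ug_along h phi a b -> ug_along h psi a b ->
  ug_along h (fun t => Order.min (phi t) (psi t)) a b.
Proof.
move=> mphi mpsi phi0 psi0 iphi ipsi uphi upsi.
suff -> : (fun t => Order.min (phi t) (psi t)) =
    mix [set t | (phi t < psi t)%E] phi psi.
  by apply: ug_along_mix => //; rewrite -(setTI [set _ | _]); exact: emeasurable_fun_lt.
apply/funext => t; rewrite /mix /Order.min.
by case: ifPn => pt; [rewrite mem_set|rewrite memNset//; exact/negP].
Qed.

(** A connectedness argument: from a point reached close to the supremum of all reached points, the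
    local hypothesis leads e/2 beyond that supremum, unless [l] comes first. *)
Lemma real_interval_chain {R : realType} (P : R -> R -> Prop) (l : R) :
  0 < l ->
  (forall a b c, 0 <= a -> a < b -> b < c -> c <= l -> P a b -> P b c -> P a c) ->
  (forall t, 0 <= t -> t <= l -> exists2 e, 0 < e & forall a b, 0 <= a -> a < b ->
     b <= l -> t - e < a -> b < t + e -> P a b) ->
  P 0 l.
Proof.
move=> l0 chain local.
(* The alternative [t = 0] starts the chain, because the hypotheses give [P a b] only for
   [a < b]. *)
pose S := [set t : R | [/\ 0 <= t, t <= l & t = 0 \/ P 0 t]].
have S0 : S 0 by split => //; [exact: ltW|left].
have Sl : ubound S l by move=> t [].
have hS : has_sup S by split; [exists 0|exists l].
have s0 : 0 <= sup S by apply: sup_upper_bound.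
have sl : sup S <= l by apply: ge_sup => //; exists 0.
have [e e0 He] := local _ s0 sl.
have [t St tS] := sup_adherent e0 hS.
have [t0 tl Pt] := St.
have ts : t <= sup S by apply: sup_upper_bound.
pose b := Order.min l (sup S + e / 2).
have bl : b <= l by rewrite /b ge_min lexx.
have be : b < sup S + e by rewrite /b gt_min; apply/orP; right; lra.
have b0 : 0 < b by rewrite /b lt_min l0/=; lra.
have tb : t <= b by rewrite /b le_min tl/=; lra.
have Pb : P 0 b.
  move: tb; rewrite le_eqVlt => /orP[/eqP tb|tb].
    by case: Pt => [t00|]; [move: b0; rewrite -tb t00 ltxx|rewrite tb].
  have Ptb : P t b by apply: He.
  case: Pt => [<-//|P0t].
  by have [->//|tn0] := eqVneq 0 t; apply: (chain 0 t b) => //; rewrite lt_neqAle tn0.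
have bs : b <= sup S by apply: sup_upper_bound => //; split; [exact: ltW| |right].
suff <- : b = l by [].
by move: bs; rewrite /b /Order.min; case: ifP => // _; lra.
Qed.

(** * Curves, subcurves and line integrals *)

(** The sigma-algebra is the Borel one, not its completion: composition with a path need not
    preserve measurability for the completion. *)
Definition borel_fun {R : realType} {T : pointedType} (dist : T -> T -> R)
    (g : T -> \bar R) : Prop :=
  measurable_fun [set: g_sigma_algebraType [set A | dopen dist A]] g.

(* Clamping the parameter makes the path 1-Lipschitz on the whole line, so that its
   compositions with Borel functions are measurable on R. *)
Definition cpath {R : realType} {T : Type} (c : curve R T) (t : R) : T :=
  c.1 (Num.max 0 (Num.min t c.2)).

Definition subcurve {R : realType} {T : Type} (c : curve R T) (a b : R) : curve R T :=
  (fun t => c.1 (a + t), b - a).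

Section curves.
Context {R : realType} {T : pointedType} (dist : T -> T -> R).
Implicit Types (E : set T) (c : curve R T) (f g : T -> \bar R).

Lemma curve_inS E1 E2 c : E1 `<=` E2 -> curve_in dist E1 c -> curve_in dist E2 c.
Proof. by move=> E12 [l0 [len Ec]]; split=> //; split=> // t t0 tl; exact/E12/Ec. Qed.

Lemma curve_in_of_points E F c : curve_in dist E c ->
  (forall t, 0 <= t -> t <= c.2 -> F (c.1 t)) -> curve_in dist F c.
Proof. by move=> [l0 [len _]] Fc. Qed.

Lemma cpath_id c t : 0 <= t -> t <= c.2 -> cpath c t = c.1 t.
Proof. by move=> t0 tl; rewrite /cpath min_l// max_r. Qed.

Lemma curve_lipschitz E c s t : curve_in dist E c -> 0 <= s -> s <= t -> t <= c.2 ->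
  dist (c.1 s) (c.1 t) <= t - s.
Proof.
move=> [l0 [len _]] s0 st tl; rewrite -lee_fin -(len s t)//.
apply: ereal_sup_ubound; exists 1%N, (fun n => if n is 0%N then s else t).
by split => //; [case|rewrite big_ord_recl big_ord0 addr0].
Qed.

Lemma dlength_translate (gamma : R -> T) (a s t : R) :
  dlength dist (fun r => gamma (a + r)) s t = dlength dist gamma (a + s) (a + t).
Proof.
congr ereal_sup; apply/seteqP; split => _ [n [u [u0 un um ->]]].
  exists n, (fun i => a + u i); split => //; rewrite ?u0 ?un//.
  by move=> i ni; rewrite lerD2l um.
exists n, (fun i => u i - a); split.
- by rewrite u0; ring.
- by rewrite un; ring.
- by move=> i ni; rewrite lerD2r um.
- by congr (_%:E); apply: eq_bigr => i _; congr (dist (gamma _) (gamma _)); ring.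
Qed.

Lemma subcurve_in E c a b : curve_in dist E c -> 0 <= a -> a < b -> b <= c.2 ->
  curve_in dist E (subcurve c a b).
Proof.
move=> [l0 [len Ec]] a0 ab bl; rewrite /subcurve; split => /=; first by rewrite subr_gt0.
split=> [s t s0 st tb|t t0 tb]; last by apply: Ec; lra.
by rewrite dlength_translate len; [congr (_%:E); ring| lra..].
Qed.

Hypothesis dist_metric : is_metric dist.

Lemma cpath_lipschitz E c s t : curve_in dist E c ->
  dist (cpath c s) (cpath c t) <= `|s - t|.
Proof.
move=> Ec; have l0 : 0 < c.2 by case: Ec.
have [_ [_ [dsym _]]] := dist_metric.
wlog st : s t / s <= t => [H|].
  by case: (leP s t) => [|/ltW] st; [exact: H|rewrite dsym distrC; exact: H].
apply: le_trans (curve_lipschitz Ec _ _ _) _.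
- by rewrite le_max lexx.
- by rewrite /Num.max/Num.min; repeat case: ifPn; rewrite -?leNgt; lra.
- by rewrite ge_max ltW//= ge_min lexx orbT.
- rewrite distrC ger0_norm ?subr_ge0//.
  by rewrite /Num.max/Num.min; repeat case: ifPn; rewrite -?leNgt; lra.
Qed.

Lemma measurable_cpath E c : curve_in dist E c ->
  measurable_fun [set: R] (cpath c : R -> g_sigma_algebraType [set A | dopen dist A]).
Proof.
move=> Ec; 
pose B := g_sigma_algebraType [set A | dopen dist A].
apply: (@measurability _ _ _ B [set: R] (cpath c) [set A | dopen dist A] erefl).
move=> _ [A oA <-]; rewrite setTI; apply: open_measurable.
rewrite openE => x /= Ax; have [r r0 rA] := oA _ Ax.
apply/nbhs_ballP; exists r => //= y; rewrite /ball/= => xy.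
by apply: rA; rewrite /dball/=; exact: le_lt_trans (cpath_lipschitz _ _ Ec) xy.
Qed.

Lemma measurable_fun_cpath E c g : curve_in dist E c -> borel_fun dist g ->
  measurable_fun [set: R] (g \o cpath c).
Proof. by move=> Ec mg; apply: measurableT_comp mg _; exact: measurable_cpath Ec. Qed.

Lemma line_int_cpath c g : line_int g c =
  (\int[lebesgue_measure]_(t in `[0%R, c.2]) g (cpath c t))%E.
Proof.
apply: eq_integral => t; rewrite inE/= in_itv/= => /andP[t0 tl].
by rewrite cpath_id.
Qed.

Lemma line_int_subcurve E c g a b : curve_in dist E c -> borel_fun dist g ->
  (forall x, 0 <= g x)%E -> 0 <= a -> b <= c.2 ->
  line_int g (subcurve c a b) =
  (\int[lebesgue_measure]_(t in `[a, b]) g (cpath c t))%E.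
Proof.
move=> Ec mg g0 a0 bl.
rewrite (@integral_itvcc_translate _ (fun t => g (cpath c t)))//; last first.
  exact: measurable_fun_cpath Ec mg.
apply: eq_integral => t; rewrite inE/= in_itv/= => /andP[t0 tl].
by rewrite cpath_id//; lra.
Qed.

Lemma ug_along_cpathP E c f g : curve_in dist E c -> borel_fun dist g ->
  (forall x, 0 <= g x)%E ->
  ug_along (f \o cpath c) (g \o cpath c) 0 c.2 <->
  (forall a b, 0 <= a -> a < b -> b <= c.2 -> ug_ineq f g (subcurve c a b)).
Proof.
move=> Ec mg g0; split => H a b a0 ab bl.
  rewrite /ug_ineq (line_int_subcurve Ec)//= addr0 subrKC.
  by rewrite -!cpath_id//; [exact: H|lra..].
have := H a b a0 ab bl; rewrite /ug_ineq (line_int_subcurve Ec)//= addr0 subrKC.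
by rewrite -!cpath_id//; lra.
Qed.

End curves.

(** * Monotonicity of integrals and of powers *)

Section lower_integral.
Import HBNNSimple.

(* Neither side need be measurable: the integral of a nonnegative function is a
   supremum over the simple functions below it. *)
Lemma ge0_le_lower_integral {R : realType} {d : measure_display}
  {T : measurableType d} (mu : {measure set T -> \bar R}) (D : set T) (f g : T -> \bar R) :
  (forall x, D x -> 0 <= f x)%E -> (forall x, D x -> f x <= g x)%E ->
  (\int[mu]_(x in D) f x <= \int[mu]_(x in D) g x)%E.
Proof.
move=> f0 fg; have g0 x : D x -> (0 <= g x)%E.
  by move=> Dx; exact: le_trans (f0 _ Dx) (fg _ Dx).
rewrite !ge0_integralE//; apply: ereal_sup_le => _ [h hf <-].
exists h => // x; apply: le_trans (hf x) _.
by rewrite !patchE; case: ifPn => // /set_mem; exact: fg.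
Qed.

End lower_integral.

Lemma ge0_le_poweR {R : realType} (r : R) (x y : \bar R) :
  0 <= r -> (0 <= x)%E -> (x <= y)%E -> (poweR x r <= poweR y r)%E.
Proof.
move=> r0 x0 xy; apply: gt0_ler_poweR => //; rewrite in_itv/= leey andbT//.
exact: le_trans xy.
Qed.

Lemma poweRK {R : realType} (r : R) (x : \bar R) : r != 0 -> (0 <= x)%E ->
  poweR (poweR x r) r^-1 = x.
Proof. by move=> r0 x0; rewrite -poweRrM mulfV// poweRe1. Qed.

Lemma poweRVK {R : realType} (r : R) (x : \bar R) : r != 0 -> (0 <= x)%E ->
  poweR (poweR x r^-1) r = x.
Proof. by move=> r0 x0; rewrite -poweRrM mulVf// poweRe1. Qed.

(** * p-integrable Borel functions and properties of almost every curve *)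

Section test_functions.
Context {R : realType} {d : measure_display} {T : measurableType d}
  (dist : T -> T -> R) (mu : {measure set T -> \bar R}) (p : R).
Hypothesis p0 : 0 < p.
Hypothesis dist_metric : is_metric dist.
Hypothesis mu_borel : complete_borel_measure dist mu.
Implicit Types (E : set T) (c : curve R T) (f g rho : T -> \bar R).

Let pn0 : p != 0. Proof. by rewrite gt_eqF. Qed.

Lemma borel_fun_measurable g : borel_fun dist g -> measurable_fun setT g.
Proof.
move=> mg _ Y mY; have [bm _] := mu_borel; apply: bm.
exact: (mg measurableT Y mY).
Qed.

Definition Lp_borel rho : Prop :=
  [/\ borel_fun dist rho, (forall x, 0 <= rho x)%E &
      (\int[mu]_x poweR (rho x) p < +oo)%E].

Lemma measurable_fun_poweR (D : set T) g : measurable_fun D g ->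
  measurable_fun D (fun x => poweR (g x) p).
Proof. by move=> mg; exact: (measurableT_comp (measurable_poweR _) mg). Qed.

Lemma borel_fun_poweR r g : borel_fun dist g -> borel_fun dist (fun x => poweR (g x) r).
Proof. by move=> mg; exact: (measurableT_comp (measurable_poweR _) mg). Qed.

(** The p-th root of the sum of the p-th powers lies above every term, and its energy is at most the
    sum of the 1/2^(n+1), which is 1. *)
Lemma Lp_borel_dominate_seq (f : nat -> T -> \bar R) :
  (forall n, borel_fun dist (f n)) -> (forall n x, 0 <= f n x)%E ->
  (forall n, \int[mu]_x poweR (f n x) p <= (1 / (2 ^ n.+1)%:R)%:E)%E ->
  exists2 rho, Lp_borel rho & forall n x, (f n x <= rho x)%E.
Proof.
move=> bf f0 If.
pose S x := (\sum_(n <oo) poweR (f n x) p)%E.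
have S0 x : (0 <= S x)%E by apply: nneseries_ge0 => n _ _; exact: poweR_ge0.
exists (fun x => poweR (S x) p^-1).
  split.
  - apply: borel_fun_poweR; apply: ge0_emeasurable_sum => [k x _ _|k _].
      exact: poweR_ge0.
    exact: borel_fun_poweR.
  - by move=> x; exact: poweR_ge0.
  - under eq_integral do rewrite poweRVK//.
    rewrite integral_nneseries//; last 2 first.
    - by move=> n; apply: measurable_fun_poweR; exact: borel_fun_measurable.
    - by move=> n x _; exact: poweR_ge0.
    apply: le_lt_trans (ltry 1); apply: le_trans (epsilon_trick0 xpredT ler01).
    by apply: lee_nneseries => // n _ _; apply: integral_ge0 => x _; exact: poweR_ge0.
move=> n x; rewrite -[leLHS](poweRK pn0)//; apply: ge0_le_poweR.
- by rewrite invr_ge0 ltW.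
- exact: poweR_ge0.
- by rewrite /S (@nneseriesD1 _ _ n)// ?leeDl//;
    [apply: nneseries_ge0 => *|move=> *]; exact: poweR_ge0.
Qed.

Lemma borel_funZ g (k : \bar R) : borel_fun dist g -> borel_fun dist (fun x => k * g x)%E.
Proof. by move=> bg; exact: emeasurable_funM. Qed.

Lemma integral_poweRZ g (k : R) : borel_fun dist g -> (forall x, 0 <= g x)%E -> 0 <= k ->
  (\int[mu]_x poweR (k%:E * g x) p = (k `^ p)%:E * \int[mu]_x poweR (g x) p)%E.
Proof.
move=> bg g0 k0; rewrite -ge0_integralZl_EFin ?powR_ge0//.
- by apply: eq_integral => x _; rewrite poweRM.
- by move=> x _; exact: poweR_ge0.
- by apply: measurable_fun_poweR; exact: borel_fun_measurable.
Qed.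

Lemma Lp_borel_scale rho (e : R) : Lp_borel rho -> 0 < e ->
  exists2 k : R, 0 < k & (\int[mu]_x poweR (k%:E * rho x) p <= e%:E)%E.
Proof.
move=> [brho rho0 rhooo] e0.
pose I := fine (\int[mu]_x poweR (rho x) p)%E.
have I0 : 0 <= I by apply: fine_ge0; apply: integral_ge0 => x _; exact: poweR_ge0.
have EI : (\int[mu]_x poweR (rho x) p = I%:E)%E.
  by rewrite fineK// ge0_fin_numE//; apply: integral_ge0 => x _; exact: poweR_ge0.
have q0 : 0 < e / (I + 1) by rewrite divr_gt0//; lra.
(* The scaled energy is [e * I / (I + 1)]; the added 1 covers the case [I = 0]. *)
exists ((e / (I + 1)) `^ p^-1); first exact: powR_gt0.
rewrite integral_poweRZ ?powR_ge0// EI -powRrM mulVf// powRr1 ?(ltW q0)//.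
by rewrite -EFinM lee_fin -mulrA ler_piMr ?(ltW e0)// mulrC ler_pdivrMr; lra.
Qed.

Lemma Lp_borel0 : Lp_borel (cst 0%E).
Proof.
split => //; first exact: measurable_cst.
by under eq_integral do rewrite poweR0r//; rewrite integral0.
Qed.

Lemma Lp_borel_max f g : Lp_borel f -> Lp_borel g ->
  Lp_borel (fun x => Order.max (f x) (g x)).
Proof.
move=> [bf f0 If] [bg g0 Ig]; split.
- exact: measurable_maxe.
- by move=> x; rewrite le_max f0.
- apply: (@le_lt_trans _ _ (\int[mu]_x (poweR (f x) p + poweR (g x) p))%E).
    apply: ge0_le_lower_integral => x _; first exact: poweR_ge0.
    by rewrite /Order.max; case: ifP => _; [rewrite leeDr|rewrite leeDl]; rewrite ?poweR_ge0.
  rewrite ge0_integralD//; first exact: lte_add_pinfty.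
  + by move=> x _; exact: poweR_ge0.
  + by apply: measurable_fun_poweR; exact: borel_fun_measurable.
  + by move=> x _; exact: poweR_ge0.
  + by apply: measurable_fun_poweR; exact: borel_fun_measurable.
Qed.

Lemma Lp_borel_le f g : borel_fun dist f -> (forall x, 0 <= f x)%E ->
  (forall x, f x <= g x)%E -> Lp_borel g -> Lp_borel f.
Proof.
move=> bf f0 fg [bg g0 Ig]; split => //; apply: le_lt_trans Ig.
apply: ge0_le_lower_integral => x _; first exact: poweR_ge0.
by apply: ge0_le_poweR => //; exact: ltW.
Qed.

Lemma le_line_int E c f g : curve_in dist E c ->
  nonneg_on E f -> (forall x, E x -> f x <= g x)%E -> (line_int f c <= line_int g c)%E.
Proof.
move=> [l0 [_ Ec]] f0 fg; apply: ge0_le_lower_integral => t;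
  rewrite /= in_itv/= => /andP[t0 tl]; [exact/f0/Ec|exact/fg/Ec].
Qed.

Lemma line_intZ E c g (k : R) : curve_in dist E c -> borel_fun dist g ->
  (forall x, 0 <= g x)%E -> 0 <= k ->
  (line_int (fun x => k%:E * g x) c = k%:E * line_int g c)%E.
Proof.
move=> Ec bg g0 k0; rewrite !line_int_cpath ge0_integralZl_EFin//.
apply: measurable_funTS; exact: measurable_fun_cpath Ec bg.
Qed.

(* The exceptional curves are those along which a fixed p-integrable Borel function has
   infinite integral; [pmodulus0_ae] and [ae_ug_pweak_ug] compare this with modulus zero. *)
Definition ae_curve (P : curve R T -> Prop) : Prop :=
  exists2 rho, Lp_borel rho &
    forall c, curve_in dist setT c -> (line_int rho c < +oo)%E -> P c.

Lemma ae_curveW (P : curve R T -> Prop) :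
  (forall c, curve_in dist setT c -> P c) -> ae_curve P.
Proof. by move=> HP; exists (cst 0%E); [exact: Lp_borel0|move=> c /HP]. Qed.

(** A positive factor does not change along which curves an exceptional function has finite
    integral; after scaling to energy at most 1/2^(n+1), a single function dominates them all. *)
Lemma ae_curve_all (P : nat -> curve R T -> Prop) :
  (forall n, ae_curve (P n)) -> ae_curve (fun c => forall n, P n c).
Proof.
move=> aeP.
have /choice[f Hf] : forall n, exists f : R * (T -> \bar R), [/\ Lp_borel f.2, 0 < f.1,
    (\int[mu]_x poweR (f.1%:E * f.2 x) p <= (1 / (2 ^ n.+1)%:R)%:E)%E &
    forall c, curve_in dist setT c -> (line_int f.2 c < +oo)%E -> P n c].
  move=> n; have [rho Lrho Prho] := aeP n.
  have e0 : 0 < 1 / (2 ^ n.+1)%:R :> R by rewrite divr_gt0// ltr0n expn_gt0.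
  by have [k k0 Ik] := Lp_borel_scale Lrho e0; exists (k, rho).
have f0 n x : (0 <= (f n).2 x)%E by have [[]] := Hf n.
have bf n : borel_fun dist (f n).2 by have [[]] := Hf n.
have [rho Lrho rhof] : exists2 rho, Lp_borel rho &
    forall n x, ((f n).1%:E * (f n).2 x <= rho x)%E.
  apply: Lp_borel_dominate_seq => [n|n x|n].
  - exact: borel_funZ.
  - by have [_ k0 _ _] := Hf n; rewrite mule_ge0// lee_fin ltW.
  - by have [] := Hf n.
exists rho => // c cc coo n; have [_ k0 _] := Hf n; apply => //.
have : (line_int (fun x => (f n).1%:E * (f n).2 x) c < +oo)%E.
  apply: le_lt_trans coo; apply: (le_line_int cc) => x _; last exact: rhof.
  by rewrite mule_ge0// lee_fin ltW.
rewrite (line_intZ cc)// ?ltW// => H; rewrite ltNge leye_eq; apply/eqP => E.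
by move: H; rewrite E mulry gtr0_sg// mul1e ltxx.
Qed.

Lemma ae_curveS (P Q : curve R T -> Prop) : (forall c, curve_in dist setT c -> P c -> Q c) ->
  ae_curve P -> ae_curve Q.
Proof.
by move=> PQ [rho Lrho Prho]; exists rho => // c cc coo; apply: PQ => //; exact: Prho.
Qed.

Lemma ae_curve_and (P Q : curve R T -> Prop) :
  ae_curve P -> ae_curve Q -> ae_curve (fun c => P c /\ Q c).
Proof.
move=> aP aQ; have := @ae_curve_all (fun n => if n is 0%N then P else Q).
move=> /(_ (fun n => if n is 0%N then aP else aQ)).
by apply: ae_curveS => c _ H; split; [exact: (H 0%N)|exact: (H 1%N)].
Qed.

(** The same exceptional function works, as its integral over a subcurve is at most that over the
    whole curve. *)
Lemma ae_curve_sub (P : curve R T -> Prop) : ae_curve P ->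
  ae_curve (fun c => forall a b, 0 <= a -> a < b -> b <= c.2 -> P (subcurve c a b)).
Proof.
move=> [rho Lrho Prho]; have [brho rho0 _] := Lrho.
exists rho => // c cc coo a b a0 ab bl; apply: Prho; first exact: subcurve_in.
apply: le_lt_trans coo; rewrite (line_int_subcurve dist_metric cc)// line_int_cpath.
apply: ge0_subset_integral => //=.
- apply: measurable_funTS; exact: measurable_fun_cpath cc brho.
- move=> t /=; rewrite !in_itv/= => /andP[at_ tb].
  by rewrite (le_trans a0 at_) (le_trans tb bl).
Qed.

Lemma ae_curve_lty g : Lp_borel g -> ae_curve (fun c => line_int g c < +oo)%E.
Proof. by move=> Lg; exists g. Qed.

(** The function equal to infinity on N and 0 elsewhere has zero energy, and its line integral is
    finite only if the curve spends zero time in N. *)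
Lemma ae_curve_null (N : set T) : dborel dist N -> mu N = 0%E ->
  ae_curve (fun c => (@lebesgue_measure R) (`[0%R, c.2] `&` cpath c @^-1` N) = 0%E).
Proof.
move=> bN N0; have mN : measurable N by apply: mu_borel.1.
have bi : borel_fun dist (fun x => (\1_N x)%:E).
  by apply/measurable_EFinP; exact: measurable_indic.
exists (fun x => (+oo * (\1_N x)%:E)%E).
  split => //; first exact: borel_funZ.
  have -> : (\int[mu]_x poweR (+oo * (\1_N x)%:E) p =
      \int[mu]_x (+oo * (\1_N x)%:E))%E.
    apply: eq_integral => x _; rewrite indicE.
    by case: (x \in N); rewrite ?mule1 ?mule0 ?poweRyr// poweR0r.
  rewrite ge0_integralZl//.
  - by rewrite integral_indic// setIT N0 mule0.
  - by apply/measurable_EFinP; exact: measurable_indic.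
move=> c cc; have mc := measurable_fun_cpath dist_metric cc bi.
have mcN : measurable (cpath c @^-1` N).
  by have := measurable_cpath dist_metric cc measurableT bN; rewrite setTI.
rewrite line_int_cpath ge0_integralZl//; last exact: measurable_funTS.
have -> : (\int[lebesgue_measure]_(t in `[0%R, c.2]) (\1_N (cpath c t))%:E)%E =
    lebesgue_measure (`[0%R, c.2] `&` cpath c @^-1` N).
  transitivity (\int[lebesgue_measure]_(t in `[0%R, c.2]) (\1_(cpath c @^-1` N) t)%:E)%E => //.
  by rewrite integral_indic//= setIC.
apply: contraPeq => nz; rewrite gt0_mulye ?ltxx// lt_neqAle eq_sym nz.
exact: measure_ge0.
Qed.

End test_functions.

(** * Borel envelopes of measurable sets and functions *)

Section borel_envelopes.
Context {R : realType} {d : measure_display} {T : measurableType d}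
  (dist : T -> T -> R) (mu : {measure set T -> \bar R}) (p : R).
Hypothesis p0 : 0 < p.
Hypothesis dist_metric : is_metric dist.
Hypothesis mu_borel : complete_borel_measure dist mu.
Implicit Types (E N U : set T) (c : curve R T) (f g rho : T -> \bar R).

Let borel_meas A : dborel dist A -> measurable A.
Proof. by have [+ _] := mu_borel; exact. Qed.

Lemma dborel_bigcup (F : nat -> set T) : (forall n, dborel dist (F n)) ->
  dborel dist (\bigcup_n F n).
Proof. by move=> bF; exact: (@sigma_algebra_bigcup _ setT). Qed.

Lemma dborel_setU A B : dborel dist A -> dborel dist B -> dborel dist (A `|` B).
Proof.
move=> bA bB.
exact: (@measurableU _ (g_sigma_algebraType [set A | dopen dist A])).
Qed.

Lemma null_bigcup (F : nat -> set T) : (forall n, measurable (F n)) ->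
  (forall n, mu (F n) = 0%E) -> mu (\bigcup_n F n) = 0%E.
Proof.
move=> mF F0; apply/negligibleP; first exact: bigcupT_measurable.
by apply: negligible_bigcup => n; apply/negligibleP; [exact: mF|exact: F0].
Qed.

(** If a null set A differs from a Borel set B only within a Borel null set M, then B lies in the
    union of A and M and is null too; the union of B and M is the hull. *)
Lemma null_dborel_hull N : mu.-negligible N ->
  exists M, [/\ dborel dist M, mu M = 0%E & N `<=` M].
Proof.
move=> [A [mA A0 NA]]; have [_ [_ /(_ _ mA)[B [M [bB [bM [M0 AB]]]]]]] := mu_borel.
exists (B `|` M); split; first exact: dborel_setU.
  have mB := borel_meas bB; have mM := borel_meas bM.
  apply/negligibleP; first exact: measurableU.
  apply: negligibleU; last by apply/negligibleP.
  apply: (@negligibleS _ _ _ _ (A `|` M)).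
    move=> x Bx; have [Ax|nAx] := pselect (A x); first by left.
    by right; apply: AB; right.
  by apply: negligibleU; apply/negligibleP.
move=> x /NA Ax; have [Bx|nBx] := pselect (B x); first by left.
by right; apply: AB; left.
Qed.

(** It is enough to approximate the countably many superlevel sets at rational heights by Borel
    sets; the value infinity on the union of the errors keeps [h] above [g]. *)
Lemma borel_modification g : measurable_fun setT g -> (forall x, 0 <= g x)%E ->
  exists h N, [/\ borel_fun dist h, forall x, (g x <= h x)%E,
    dborel dist N, mu N = 0%E & forall x, ~ N x -> h x = g x].
Proof.
move=> mg g0.
(* An enumeration of the rationals; codes of no rational yield 0, a harmless repetition. *)
pose q (n : nat) : R := ratr (odflt 0 (unpickle n : option rat)).
pose A n := [set x | ((q n)%:E < g x)%E].
have mA n : measurable (A n).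
  by rewrite /A -(setTI [set _ | _]); apply: emeasurable_fun_lt => //; exact: measurable_cst.
have /choice[BN HBN] n : exists BN : set T * set T, [/\ dborel dist BN.1,
    dborel dist BN.2, mu BN.2 = 0%E & (A n `\` BN.1) `|` (BN.1 `\` A n) `<=` BN.2].
  have [_ [_ /(_ _ (mA n))[B [M [bB [bM [M0 AB]]]]]]] := mu_borel.
  by exists (B, M).
pose N := \bigcup_n (BN n).2.
have bN : dborel dist N by apply: dborel_bigcup => n; have [] := HBN n.
exists (fun x => if x \in N then +oo%E else g x), N; split => //.
- move=> mT; apply: (measurability _ (ErealGenOInfty.measurableE R)) => //.
  move=> _ [_ [r ->] <-]; rewrite setTI.
  (* N lies in every superlevel set because [h] is infinite there; off N, a rational between [r] and
     the value of [g] selects a Borel approximation. *)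
  rewrite (_ : _ @^-1` _ = N `|` \bigcup_(n in [set n | r < q n]) (BN n).1).
    apply: dborel_setU => //.
    apply: (@bigcup_measurable _ (g_sigma_algebraType [set A | dopen dist A])) => n _.
    by have [] := HBN n.
  apply/seteqP; split => x /=; rewrite in_itv/= andbT.
    case: ifPn => [/set_mem xN _|/negP xN rx]; first by left.
    have nx : ~ N x by move=> Nx; apply: xN; exact: mem_set.
    right; have [s rs sg] : exists2 s : rat, r < ratr s & ((ratr s)%:E < g x)%E.
      case: (g x) rx => [y|_|//]; last first.
        have rr1 : r < r + 1 by rewrite ltrDl.
        have [s] := rat_in_itvoo rr1.
        by rewrite in_itv/= => /andP[rs _]; exists s => //; exact: ltry.
      rewrite lte_fin => ry; have [s] := rat_in_itvoo ry.
      by rewrite in_itv/= => /andP[rs sy]; exists s.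
    have qs : q (pickle s) = ratr s by rewrite /q pickleK.
    exists (pickle s); first by rewrite /= qs.
    have [_ _ _ sub] := HBN (pickle s); apply: contrapT => nB.
    by apply: nx; exists (pickle s) => //; apply: sub; left; split => //; rewrite /A/= qs.
  move=> [xN|[n /= rq Bx]]; first by rewrite mem_set// ltry.
  case: ifPn => [_|/negP xN]; first exact: ltry.
  have [_ _ _ sub] := HBN n; apply: (@lt_trans _ _ (q n)%:E); first by rewrite lte_fin.
  apply: contrapT => nA; apply: xN; apply: mem_set; exists n => //.
  by apply: sub; right; split.
- by move=> x; case: ifP => // _; rewrite leey.
- apply: null_bigcup => n; have [_ bN2 N20 _] := HBN n => //.
  exact: borel_meas.
- by move=> x nx; rewrite memNset.
Qed.

(** Extending [g] by 0 outside E before the modification gives a majorant on the whole space with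
    the same energy. *)
Lemma borel_majorant E g : measurable E -> measurable_fun E g -> nonneg_on E g ->
  exists h, [/\ borel_fun dist h, forall x, (0 <= h x)%E,
    forall x, E x -> (g x <= h x)%E, {ae mu, forall x, E x -> h x = g x} &
    (\int[mu]_x poweR (h x) p = \int[mu]_(x in E) poweR (g x) p)%E].
Proof.
move=> mE mg g0.
have r0 x : (0 <= (g \_ E) x)%E by rewrite patchE; case: ifPn => // /set_mem /g0.
have mr : measurable_fun setT (g \_ E) by apply/(measurable_restrictT _ mE).
have [h [N [bh gh bN N0 hN]]] := borel_modification mr r0.
have aeh : {ae mu, forall x, h x = (g \_ E) x}.
  exists N; split => //; first exact: borel_meas.
  by move=> x /= nh; apply: contrapT => /hN.
exists h; split => //.
- by move=> x; exact: le_trans (r0 x) (gh x).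
- by move=> x Ex; have := gh x; rewrite patchE mem_set.
- by apply: filterS aeh => x -> Ex; rewrite patchE mem_set.
- rewrite [RHS]integral_mkcond.
  rewrite (_ : (fun x => poweR (g x) p) \_ E = fun x => poweR ((g \_ E) x) p).
    apply: ge0_ae_eq_integral => //.
    - by apply: measurable_fun_poweR; exact: (borel_fun_measurable mu_borel bh).
    - exact: measurable_fun_poweR.
    - by move=> x _; exact: poweR_ge0.
    - by move=> x _; exact: poweR_ge0.
    - by apply: filterS aeh => x -> _.
  apply/funext => x; rewrite !patchE; case: ifPn => // _.
  by rewrite poweR0r// gt_eqF.
Qed.

Lemma borel_on_fun g : borel_on dist setT g -> borel_fun dist g.
Proof.
move=> bg _ Y mY; have [A bA] := bg Y mY; rewrite !setTI => ->; exact: bA.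
Qed.

Lemma borel_fun_on E g : borel_fun dist g -> borel_on dist E g.
Proof.
move=> bg B mB; exists (g @^-1` B) => //.
by have := bg measurableT B mB; rewrite setTI.
Qed.

Lemma borel_on_measurable E g : measurable E -> borel_on dist E g -> measurable_fun E g.
Proof.
move=> mE bg _ Y mY; have [A bA ->] := bg Y mY; apply: measurableI => //.
exact: borel_meas.
Qed.

(* v is only measurable for the completed sigma-algebra, hence the Borel majorant w
   of its absolute value, which can be integrated along curves. *)
Lemma Cp_lt_witness (G : set T) (e : \bar R) : (Cp dist mu p G < e)%E ->
  exists v w g, [/\ forall x, G x -> (1 <= v x)%E,
    forall x, (`|v x| <= w x)%E,
    Lp_borel dist mu p w /\ (\int[mu]_x poweR (w x) p < e)%E,
    Lp_borel dist mu p g /\ (\int[mu]_x poweR (g x) p < e)%E &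
    forall c, curve_in dist setT c -> ug_ineq v g c].
Proof.
move=> /ereal_inf_lt[_ [v [[mv _] Gv] <-]]; rewrite /N1p_energy => Ee.
have inf0 : (0 <= ereal_inf [set (\int[mu]_(x in setT) poweR (g x) p)%E
    | g in upper_gradient dist setT v])%E.
  by apply: le_ereal_inf_tmp => _ [g _ <-]; apply: integral_ge0 => x _; exact: poweR_ge0.
have int0 : (0 <= \int[mu]_x poweR `|v x| p)%E.
  by apply: integral_ge0 => x _; exact: poweR_ge0.
have /ereal_inf_lt[_ [g [bg [g0 ugg]] <-] ge] := le_lt_trans (leeDr _ int0) Ee.
have ve := le_lt_trans (leeDl _ inf0) Ee.
have mav : measurable_fun setT (fun x => `|v x|%E) by exact: measurableT_comp.
have [w [bw w0 vw _ Iw]] := borel_majorant measurableT mav (fun x _ => abse_ge0 (v x)).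
exists v, w, g; split => //.
- by move=> x; exact: vw.
- by split; [split => //|]; rewrite Iw//; exact: lt_le_trans ve (leey _).
- split => //; split; first exact: borel_on_fun.
    by move=> x; exact: g0.
  exact: lt_le_trans ge (leey _).
Qed.

(** * Curves that avoid sets of small capacity *)

Definition avoids (G : set T) c : Prop := forall t, 0 <= t -> t <= c.2 -> ~ G (c.1 t).

(* If a test function has energy below this bound, then 2^n times it has energy below
   1/2^(n+1). *)
Definition cap_radius (n : nat) : R := ((2 ^ n)%:R `^ p)^-1 * (1 / (2 ^ n.+1)%:R).

Let pow2_gt0 n : 0 < (2 ^ n)%:R :> R. Proof. by rewrite ltr0n expn_gt0. Qed.

Lemma cap_radius_gt0 n : 0 < cap_radius n.
Proof. by rewrite mulr_gt0 ?invr_gt0 ?powR_gt0// divr_gt0. Qed.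

(** One function [rho] dominates every [2 ^ n * f n], so the integral of [f n] along a curve is at
    most 1/2^n times that of [rho]. *)
Lemma dominate_scaled_seq (f : nat -> T -> \bar R) :
  (forall n, Lp_borel dist mu p (f n)) ->
  (forall n, (\int[mu]_x poweR (f n x) p < (cap_radius n)%:E)%E) ->
  exists2 rho, Lp_borel dist mu p rho &
    forall c, curve_in dist setT c -> (line_int rho c < +oo)%E ->
    forall e : R, 0 < e -> exists m, forall n, (m <= n)%N -> (line_int (f n) c < e%:E)%E.
Proof.
move=> Lf If; have f0 n x : (0 <= f n x)%E by have [] := Lf n.
have bf n : borel_fun dist (f n) by have [] := Lf n.
have [rho Lrho rhof] : exists2 rho, Lp_borel dist mu p rho &
    forall n x, ((2 ^ n)%:R%:E * f n x <= rho x)%E.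
  apply: Lp_borel_dominate_seq => // [n|n x|n].
  - exact: borel_funZ.
  - by rewrite mule_ge0.
  - rewrite (integral_poweRZ _ mu_borel)//.
    apply: (@le_trans _ _ (((2 ^ n)%:R `^ p)%:E * (cap_radius n)%:E)%E).
      by apply: lee_wpmul2l; [rewrite lee_fin powR_ge0|exact: ltW].
    by rewrite -EFinM /cap_radius mulVKf ?lexx// gt_eqF// powR_gt0.
exists rho => // c cc coo e e0.
have [_ rho0 _] := Lrho.
have I0 : (0 <= line_int rho c)%E by apply: integral_ge0.
have [M EM] : exists M, line_int rho c = M%:E.
  by exists (fine (line_int rho c)); rewrite fineK// ge0_fin_numE.
(* [M / e] is below this bound, hence below [n] and below [2 ^ n]. *)
exists (Num.bound (M / e)) => n bn.
have : (line_int (fun x => (2 ^ n)%:R%:E * f n x) c <= M%:E)%E.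
  by rewrite -EM; apply: (le_line_int cc) => x _; [rewrite mule_ge0|exact: rhof].
rewrite (line_intZ dist_metric cc)// -lee_pdivlMl// => /le_lt_trans; apply.
rewrite -EFinM lte_fin mulrC ltr_pdivrMr// mulrC -ltr_pdivrMr//.
have M0 : 0 <= M / e by rewrite divr_ge0// ?(ltW e0)// -lee_fin -EM.
apply: lt_le_trans (archi_boundP M0) _.
by rewrite ler_nat (leq_trans bn)// ltnW// ltn_expl.
Qed.

(* Along a curve that meets G_n, the function v_n varies by less than 1/2 and hence
   is at least 1/2 throughout, which contradicts the smallness of its integral. *)
Lemma ae_curve_avoids (G : nat -> set T) :
  (forall n, (Cp dist mu p (G n) < (cap_radius n)%:E)%E) ->
  ae_curve dist mu p (fun c => exists n, avoids (G n) c).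
Proof.
move=> CG.
have /choice[F HF] n := Cp_lt_witness (CG n).
have /choice[F2 HF2] n := HF n.
have {HF HF2} /choice[F3 H] n := HF2 n.
have [rho1 L1 H1] : exists2 rho, Lp_borel dist mu p rho &
    forall c, curve_in dist setT c -> (line_int rho c < +oo)%E ->
    forall e : R, 0 < e -> exists m, forall n, (m <= n)%N -> (line_int (F2 n) c < e%:E)%E.
  by apply: dominate_scaled_seq => n; have [_ _ []] := H n.
have [rho2 L2 H2] : exists2 rho, Lp_borel dist mu p rho &
    forall c, curve_in dist setT c -> (line_int rho c < +oo)%E ->
    forall e : R, 0 < e -> exists m, forall n, (m <= n)%N -> (line_int (F3 n) c < e%:E)%E.
  by apply: dominate_scaled_seq => n; have [_ _ _ []] := H n.
have := ae_curve_and p0 dist_metric mu_borel (ae_curve_lty L1) (ae_curve_lty L2).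
apply: ae_curveS => c cc [c1 c2].
have l0 : 0 < c.2 by case: cc.
(* The threshold is the integral of the constant 1/2 along the curve, which the majorant of the test
   function would have to reach. *)
have l2 : 0 < c.2 / 2 by rewrite divr_gt0.
have [N1 HN1] := H1 c cc c1 _ l2.
have h12 : 0 < 1 / 2 :> R by rewrite divr_gt0.
have [N2 HN2] := H2 c cc c2 _ h12.
pose n := maxn N1 N2; exists n => t t0 tl Gt.
have [G1 vw [[bw w0 _] _] [[bg g0 _] _] vug] := H n.
have ge12 s : 0 <= s -> s <= c.2 -> ((1 / 2)%:E <= F2 n (c.1 s))%E.
  move=> s0 sl; apply: le_trans (vw _).
  have sub a b : 0 <= a -> a < b -> b <= c.2 ->
      (ug_lhs (F n (c.1 a)) (F n (c.1 b)) < (1 / 2)%:E)%E.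
    move=> a0 ab bl.
    have := vug _ (subcurve_in cc a0 ab bl); rewrite /ug_ineq/= addr0 subrKC => /le_lt_trans; apply.
    apply: le_lt_trans (HN2 n (leq_maxr _ _)).
    rewrite (line_int_subcurve dist_metric cc)// line_int_cpath.
    apply: ge0_subset_integral => //=.
    - by apply: measurable_funTS; exact: measurable_fun_cpath cc bg.
    - move=> r /=; rewrite !in_itv/= => /andP[ar rb].
      by rewrite (le_trans a0 ar) (le_trans rb bl).
  have vt := G1 _ Gt.
  (* An oscillation below 1/2 also excludes infinite values, so both strict cases compare real
     numbers. *)
  have [st|ts|->] := ltgtP s t; last first.
  - by apply: le_trans (lee_abs _); apply: le_trans vt; rewrite lee_fin; lra.
  - have := sub _ _ t0 ts sl; rewrite /ug_lhs; case: ifP => // /andP[].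
    case: (F n (c.1 s)) => // x; case: (F n (c.1 t)) vt => // y; rewrite !lee_fin => y1 _ _.
    rewrite lte_fin => xy; have := ler_norm (y - x); have := ler_norm x.
    by move: xy; rewrite /= => + + +; lra.
  - have := sub _ _ s0 st tl; rewrite /ug_lhs; case: ifP => // /andP[].
    case: (F n (c.1 s)) => // x; case: (F n (c.1 t)) vt => // y; rewrite !lee_fin => y1 _ _.
    rewrite lte_fin distrC => xy; have := ler_norm (y - x); have := ler_norm x.
    by move: xy; rewrite /= => + + +; lra.
have := HN1 n (leq_maxl _ _); rewrite ltNge => /negP; apply.
apply: (@le_trans _ _ (\int[lebesgue_measure]_(s in `[0%R, c.2]) (1 / 2)%:E)%E).
  rewrite integral_cst//= lebesgue_measure_itv/= lte_fin l0 oppr0 adde0 -EFinM lee_fin.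
  lra.
apply: ge0_le_lower_integral => s /=; first by rewrite lee_fin.
by rewrite in_itv/= => /andP[s0 sl]; exact: ge12.
Qed.

Lemma ae_curve_avoids_null (Z : set T) : Cp dist mu p Z = 0%E ->
  ae_curve dist mu p (avoids Z).
Proof.
move=> Z0; have := @ae_curve_avoids (fun=> Z).
have H n : (Cp dist mu p Z < (cap_radius n)%:E)%E by rewrite Z0 lte_fin cap_radius_gt0.
by move=> /(_ H); apply: ae_curveS => c _ [].
Qed.

(** * Capacity against measure, and quasiopen sets *)

(** Chebyshev's inequality for the set where the Borel majorant of a test function is at least 1. *)
Lemma Cp_lt_cover (G : set T) (e : \bar R) : (Cp dist mu p G < e)%E ->
  exists B, [/\ measurable B, G `<=` B & (mu B < e)%E].
Proof.
move=> /Cp_lt_witness[v [w [_ [Gv vw [[bw w0 _] Iw] _ _]]]].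
pose B := [set x | (1 <= w x)%E].
have mw := borel_fun_measurable mu_borel bw.
have mB : measurable B.
  by rewrite /B -(setTI [set _ | _]); apply: emeasurable_fun_le => //; exact: measurable_cst.
exists B; split => //.
  by move=> x Gx; apply: le_trans (vw x); apply: le_trans (lee_abs _); exact: Gv.
apply: le_lt_trans Iw; rewrite -[B]setIT -integral_indic//.
apply: ge0_le_lower_integral => x _; first by rewrite lee_fin.
rewrite indicE; case: (boolP (x \in B)) => [/set_mem Bx|_]; last exact: poweR_ge0.
have := ge0_le_poweR (ltW p0) lee01 Bx; by rewrite poweR1r.
Qed.

Lemma negligible_small_cover (Z : set T) :
  (forall e : R, 0 < e -> exists B, [/\ measurable B, Z `<=` B & (mu B < e%:E)%E]) ->
  mu.-negligible Z.
Proof.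
move=> HZ; have e0 n : 0 < n.+1%:R^-1 :> R by rewrite invr_gt0.
have /choice[B HB] n := HZ _ (e0 n).
have mB : measurable (\bigcap_n B n) by apply: bigcapT_measurable => n; have [] := HB n.
exists (\bigcap_n B n); split => //; last first.
  by move=> x Zx n _; have [_ + _] := HB n; exact.
apply/eqP; rewrite eq_le measure_ge0 andbT; apply/lee_addgt0Pr => e ep; rewrite add0e.
pose n := Num.bound e^-1.
have [mBn _ Bn] := HB n; apply: (@le_trans _ _ (mu (B n))).
  by apply: le_measure; rewrite ?inE//; apply: bigcap_inf.
apply: ltW; apply: lt_trans Bn _; rewrite lte_fin; exact: invr_bound_lt.
Qed.

Lemma Cp_negligible (Z : set T) : Cp dist mu p Z = 0%E -> mu.-negligible Z.
Proof.
by move=> Z0; apply: negligible_small_cover => e e0; apply: Cp_lt_cover; rewrite Z0.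
Qed.

(** The countable intersection W of the open sets formed from U and [G n] is Borel, and W minus U
    lies in every [G n], hence is null and measurable by completeness. *)
Lemma quasiopen_measurable U : quasiopen dist mu p U -> measurable U.
Proof.
move=> qU; have e0 n : 0 < n.+1%:R^-1 :> R by rewrite invr_gt0.
have /choice[G HG] n := qU _ (e0 n).
pose W := \bigcap_n (U `|` G n).
have mW : measurable W.
  apply: bigcapT_measurable => n; apply: borel_meas; apply: sub_sigma_algebra.
  by have [] := HG n.
have [M [mM M0 WM]] : mu.-negligible (W `\` U).
  apply: negligible_small_cover => e ep.
  pose n := Num.bound e^-1.
  have [_ Ge _] := HG n; have [|B [mB GB Be]] := @Cp_lt_cover (G n) e%:E.
    by apply: lt_trans Ge _; rewrite lte_fin; exact: invr_bound_lt.
  by exists B; split => // x [/(_ n I)[//|/GB]].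
have [_ [complete _]] := mu_borel.
have mWU := complete M mM M0 _ WM.
suff -> : U = W `\` (W `\` U) by exact: measurableD.
rewrite setDD; apply/seteqP; split => x; last by case.
by move=> Ux; split => // n _; left.
Qed.

(** Along a curve that avoids [G n], the set U coincides with the open union of U and [G n]. *)
Lemma quasiopen_path_open U : quasiopen dist mu p U ->
  ae_curve dist mu p (fun c => forall t, 0 <= t -> t <= c.2 -> U (c.1 t) ->
    exists2 e, 0 < e & forall s, 0 <= s -> s <= c.2 -> `|s - t| < e -> U (c.1 s)).
Proof.
move=> qU; have /choice[G HG] n := qU _ (cap_radius_gt0 n).
have := @ae_curve_avoids G (fun n => let: And3 _ h _ := HG n in h).
apply: ae_curveS => c cc [n av] t t0 tl Ut.
have [_ _ oUG] := HG n; have [e e0 sub] := oUG (c.1 t) (or_introl Ut).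
exists e => // s s0 sl st.
have : (U `|` G n) (c.1 s).
  apply: sub; rewrite /dball/= -!(cpath_id _ _)//.
  by apply: le_lt_trans (cpath_lipschitz dist_metric _ _ cc) _; rewrite distrC.
by case=> // Gs; have := av s s0 sl Gs.
Qed.

End borel_envelopes.

(** * Weak upper gradients as inequalities along almost every curve *)

Section fine_gradients.
Context {R : realType} {d : measure_display} {T : measurableType d}
  (dist : T -> T -> R) (mu : {measure set T -> \bar R}) (p : R).
Hypothesis p0 : 0 < p.
Hypothesis dist_metric : is_metric dist.
Hypothesis mu_borel : complete_borel_measure dist mu.
Implicit Types (E U V : set T) (c : curve R T) (f g h rho u : T -> \bar R).

Local Notation Lpb := (Lp_borel dist mu p).
Local Notation aec := (ae_curve dist mu p).

Lemma le_integralT E g : measurable E -> measurable_fun setT g -> (forall x, 0 <= g x)%E ->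
  (\int[mu]_(x in E) poweR (g x) p <= \int[mu]_x poweR (g x) p)%E.
Proof.
move=> mE mg g0; apply: ge0_subset_integral => //.
- exact: measurable_fun_poweR.
- by move=> x _; exact: poweR_ge0.
Qed.

Lemma Lp_borel_Lp_on E g : measurable E -> Lpb g -> Lp_on mu p E g.
Proof.
move=> mE [bg g0 Ig]; have mg := borel_fun_measurable mu_borel bg.
split; first exact: measurable_funTS.
apply: le_lt_trans Ig; apply: le_trans (le_integralT mE mg g0).
by apply: ge0_le_lower_integral => x _; [exact: poweR_ge0|rewrite gee0_abs].
Qed.

Lemma Lp_on_majorant E g : measurable E -> Lp_on mu p E g -> nonneg_on E g ->
  exists h, [/\ Lpb h, forall x, E x -> (g x <= h x)%E &
    {ae mu, forall x, E x -> h x = g x}].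
Proof.
move=> mE [mg Ig] g0; have [h [bh h0 gh hg Ih]] := borel_majorant p0 mu_borel mE mg g0.
exists h; split => //; split => //; rewrite Ih; apply: le_lt_trans Ig.
by apply: ge0_le_lower_integral => x Ex; [exact: poweR_ge0|rewrite gee0_abs// g0].
Qed.

(** The exceptional curves are controlled by a function on the whole space, even though only curves
    in E matter; this makes restriction to subsets immediate. *)
Definition ae_ug E f g : Prop := aec (fun c => curve_in dist E c -> ug_ineq f g c).

Lemma curve_inT E c : curve_in dist E c -> curve_in dist setT c.
Proof. exact: curve_inS. Qed.

Lemma ae_ugS E V f g : V `<=` E -> ae_ug E f g -> ae_ug V f g.
Proof. by move=> VE; apply: ae_curveS => c _ H cV; apply: H; exact: curve_inS cV. Qed.

(** Admissible functions of rapidly decreasing energy have line integrals tending to 0 along almost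
    every curve, yet these are at least 1 on the curves of [G] in E. *)
Lemma pmodulus0_ae E (G : set (curve R T)) : measurable E ->
  pmodulus dist mu p E G = 0%E -> aec (fun c => curve_in dist E c -> ~ G c).
Proof.
move=> mE G0.
have /choice[h Hh] n : exists h, [/\ Lpb h,
    (\int[mu]_x poweR (h x) p < (cap_radius p n)%:E)%E &
    forall c, curve_in dist E c -> G c -> (1 <= line_int h c)%E].
  have : (pmodulus dist mu p E G < (cap_radius p n)%:E)%E.
    by rewrite G0 lte_fin cap_radius_gt0.
  move=> /ereal_inf_lt[_ [rho [brho [rho0 rhoG]] <-]] Irho.
  have [h [bh h0 rh _ Ih]] := borel_majorant p0 mu_borel mE
    (borel_on_measurable mu_borel mE brho) rho0.
  rewrite -Ih in Irho; exists h; split => //.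
    by split => //; exact: lt_le_trans Irho (leey _).
  by move=> c cE Gc; apply: le_trans (rhoG c Gc) _; exact: le_line_int cE rho0 rh.
have [rho Lrho Hrho] : exists2 rho, Lpb rho &
    forall c, curve_in dist setT c -> (line_int rho c < +oo)%E ->
    forall e : R, 0 < e -> exists m, forall n, (m <= n)%N -> (line_int (h n) c < e%:E)%E.
  by apply: dominate_scaled_seq => // n; have [] := Hh n.
exists rho => // c cT coo cE Gc; have [m] := Hrho c cT coo 1 ltr01.
move=> /(_ m (leqnn _)); rewrite ltNge => /negP; apply.
by have [_ _] := Hh m; exact.
Qed.

(** This allows a value on a null set to be replaced by infinity or by 0, which turns almost
    everywhere comparisons into pointwise ones. *)
Lemma line_int_mix_null E c (N : set T) h (k : \bar R) : curve_in dist E c ->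
  dborel dist N -> (@lebesgue_measure R) (`[0%R, c.2] `&` cpath c @^-1` N) = 0%E ->
  borel_fun dist h -> (forall x, 0 <= h x)%E -> (0 <= k)%E ->
  line_int (mix N (cst k) h) c = line_int h c.
Proof.
move=> cE bN cN bh h0 k0; rewrite !line_int_cpath.
have bm : borel_fun dist (mix N (cst k) h).
  by apply: measurable_mix => //; exact: measurable_cst.
have mcm := measurable_fun_cpath dist_metric cE bm.
have mch := measurable_fun_cpath dist_metric cE bh.
apply: ge0_ae_eq_integral => //.
- exact: (measurable_funTS mcm).
- exact: (measurable_funTS mch).
- by move=> t _; rewrite /mix; case: ifP.
- exists (`[0%R, c.2] `&` cpath c @^-1` N); split => //.
    apply: measurableI => //.
    by have := measurable_cpath dist_metric cE measurableT bN; rewrite setTI.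
  move=> t /=; apply: contra_notP => nt tl; rewrite /mix memNset// => Nt.
  by apply: nt.
Qed.

(** Raised to infinity on a Borel null set, [h] dominates [g] at every point of E, while its
    integral along almost every curve stays the same. *)
Lemma pweak_ug_ae_ug E f g h : measurable E -> pweak_ug dist mu p E f g ->
  borel_fun dist h -> (forall x, 0 <= h x)%E ->
  {ae mu, forall x, E x -> (g x <= h x)%E} -> ae_ug E f h.
Proof.
move=> mE [mg [g0 [G [_ [G0 ugG]]]]] bh h0 gh.
have [N [bN N0 subN]] := null_dborel_hull mu_borel gh.
have := ae_curve_and p0 dist_metric mu_borel (pmodulus0_ae mE G0)
  (ae_curve_null p0 dist_metric mu_borel bN N0).
apply: ae_curveS => c _ [nG cN] cE.
apply: le_trans (ugG c cE (nG cE)) _.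
rewrite -(line_int_mix_null cE bN cN bh h0 (leey 0%E)).
apply: (le_line_int cE) => // x Ex; rewrite /mix.
case: ifPn => [_|/negP xN]; first exact: leey.
by apply: contrapT => ngh; apply: xN; apply: mem_set; apply: subN => /= /(_ Ex).
Qed.

(** Lowered to 0 on a Borel null set, [h] stays below [g] at every point of E. *)
Lemma ae_ug_pweak_ug E f g h : measurable E -> measurable_fun E g -> nonneg_on E g ->
  borel_fun dist h -> (forall x, 0 <= h x)%E ->
  {ae mu, forall x, E x -> (h x <= g x)%E} -> ae_ug E f h -> pweak_ug dist mu p E f g.
Proof.
move=> mE mg g0 bh h0 hg ugh.
have [N [bN N0 subN]] := null_dborel_hull mu_borel hg.
have [rho Lrho Hrho] : aec (fun c => curve_in dist E c -> ug_ineq f g c).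
  have := ae_curve_and p0 dist_metric mu_borel ugh
    (ae_curve_null p0 dist_metric mu_borel bN N0).
  apply: ae_curveS => c _ [ugc cN] cE; apply: le_trans (ugc cE) _.
  rewrite -(line_int_mix_null cE bN cN bh h0 (lexx 0%E)).
  apply: (le_line_int cE) => x Ex; rewrite /mix.
    by case: ifP.
  case: ifPn => [_|/negP xN]; first exact: g0.
  by apply: contrapT => ngh; apply: xN; apply: mem_set; apply: subN => /= /(_ Ex).
split => //; split => //.
exists [set c | curve_in dist E c /\ ~ ug_ineq f g c]; split; first by move=> c [].
split; last by move=> c cE nG; apply: contrapT => nug; exact: nG.
have [brho rho0 _] := Lrho; have mrho := borel_fun_measurable mu_borel brho.
apply/eqP; rewrite eq_le; apply/andP; split; last first.
  by apply: le_ereal_inf_tmp => _ [r _ <-]; apply: integral_ge0 => x _; exact: poweR_ge0.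
apply/lee_addgt0Pr => e e0; rewrite add0e.
(* Every positive multiple of [rho] is admissible, since [rho] has infinite integral along the
   exceptional curves; a small multiple has energy at most [e]. *)
have [k k0 Ik] := Lp_borel_scale p0 mu_borel Lrho e0.
have bk : borel_fun dist (fun x => k%:E * rho x)%E by exact: borel_funZ.
have kr0 x : (0 <= k%:E * rho x)%E by rewrite mule_ge0// lee_fin ltW.
apply: le_trans Ik; apply: le_trans (le_integralT mE (borel_fun_measurable mu_borel bk) kr0).
apply: ereal_inf_lbound; exists (fun x => k%:E * rho x)%E => //; split.
  exact: borel_fun_on.
split; first by move=> x _.
move=> c [cE nug]; rewrite (line_intZ dist_metric cE)// ?(ltW k0)//.
have -> : line_int rho c = +oo%E.
  apply/eqP; rewrite -leye_eq leNgt; apply/negP => coo; apply: nug.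
  exact: Hrho (curve_inT cE) coo cE.
by rewrite gt0_muley ?lte_fin// leey.
Qed.

(** The maximum of [h] and the exceptional function has infinite integral along the exceptional
    curves and dominates [h] on all others. *)
Lemma ae_ug_upper_gradient E f h : Lpb h -> ae_ug E f h ->
  exists2 g, Lpb g & upper_gradient dist E f g.
Proof.
move=> Lh [rho Lrho Hrho]; have Lm := Lp_borel_max mu_borel Lh Lrho.
have [bm m0 _] := Lm; have [_ h0 _] := Lh; have [_ rho0 _] := Lrho.
eexists; first exact: Lm.
split; [exact: borel_fun_on|split=> [x _//|c cE]].
have [coo|] := ltP (line_int rho c) +oo%E.
  apply: le_trans (Hrho c (curve_inT cE) coo cE) _.
  by apply: (le_line_int cE) => x _; rewrite // le_max lexx.
rewrite leye_eq => /eqP coo; apply: (@le_trans _ _ (line_int rho c)).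
  by rewrite coo leey.
by apply: (le_line_int cE) => x _; rewrite // le_max lexx orbT.
Qed.

Lemma upper_gradient_ae_ug E f g h : upper_gradient dist E f g ->
  (forall x, E x -> (g x <= h x)%E) -> ae_ug E f h.
Proof.
move=> [_ [g0 ugg]] gh; apply: ae_curveW => // c _ cE.
by apply: le_trans (ugg c cE) _; exact: le_line_int cE g0 gh.
Qed.

Lemma ae_ug_along E f g : Lpb g -> ae_ug E f g ->
  aec (fun c => curve_in dist E c -> ug_along (f \o cpath c) (g \o cpath c) 0 c.2).
Proof.
move=> [bg g0 _] /(ae_curve_sub dist_metric); apply: ae_curveS => c _ H cE.
apply/(ug_along_cpathP dist_metric f cE bg g0) => a b a0 ab bl.
by apply: H => //; exact: subcurve_in.
Qed.

Lemma ae_ug_min E f g h : Lpb g -> Lpb h -> ae_ug E f g -> ae_ug E f h ->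
  ae_ug E f (fun x => Order.min (g x) (h x)).
Proof.
move=> Lg Lh ugg ugh; have [bg g0 _] := Lg; have [bh h0 _] := Lh.
have A := ae_curve_and p0 dist_metric mu_borel (ae_ug_along Lg ugg) (ae_ug_along Lh ugh).
have B := ae_curve_and p0 dist_metric mu_borel (ae_curve_lty Lg) (ae_curve_lty Lh).
apply: ae_curveS (ae_curve_and p0 dist_metric mu_borel A B) => c _ [[cg ch] [ig ih]] cE.
have l0 : 0 < c.2 by case: cE.
have := @ug_along_min _ (f \o cpath c) (g \o cpath c) (h \o cpath c) 0 c.2
  (measurable_fun_cpath dist_metric cE bg) (measurable_fun_cpath dist_metric cE bh)
  (fun t => g0 _) (fun t => h0 _).
rewrite /= -!line_int_cpath => /(_ ig ih (cg cE) (ch cE)) /(_ 0 c.2 (lexx _) l0 (lexx _)).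
by rewrite /ug_ineq line_int_cpath /= !cpath_id// ltW.
Qed.

(** Along almost every curve the first function is integrable and serves as the majorant for
    dominated convergence. *)
Lemma ae_ug_lim E f (g_ : nat -> T -> \bar R) g : (forall n, Lpb (g_ n)) ->
  (forall n x, (g_ n x <= g_ 0%N x)%E) -> (forall x, g_ ^~ x @ \oo --> g x) ->
  (forall n, ae_ug E f (g_ n)) -> ae_ug E f g.
Proof.
move=> Lg gle glim ugg.
have A := ae_curve_all p0 dist_metric mu_borel ugg.
apply: ae_curveS (ae_curve_and p0 dist_metric mu_borel A (ae_curve_lty (Lg 0%N))).
move=> c _ [cg c0] cE; rewrite /ug_ineq line_int_cpath.
have mc n : measurable_fun [set: R] (g_ n \o cpath c).
  by have [bg _ _] := Lg n; exact: (measurable_fun_cpath dist_metric cE bg).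
apply: (@le_integral_dominated_lim R _ (measurableTypeR R) lebesgue_measure _
  (fun n => g_ n \o cpath c) _ (g_ 0%N \o cpath c)) => //.
- by move=> n; exact: (measurable_funTS (mc n)).
- exact: (measurable_funTS (mc 0%N)).
- by move=> n t _; split; [have [_ + _] := Lg n; exact|exact: gle].
- by rewrite -line_int_cpath.
- by move=> t _; exact: glim.
- by move=> n; rewrite -line_int_cpath; exact: cg.
Qed.

(** * Existence of a least gradient *)

Lemma ae_eq_of_integral_le (q g : T -> \bar R) : measurable_fun setT q ->
  measurable_fun setT g -> (forall x, 0 <= q x)%E -> (forall x, q x <= g x)%E ->
  (\int[mu]_x g x <= \int[mu]_x q x)%E -> (\int[mu]_x q x < +oo)%E ->
  {ae mu, forall x, q x = g x}.
Proof.
move=> mq mg q0 qg Igq Iq.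
pose D := [set x | (q x < g x)%E].
have mD : measurable D by rewrite /D -(setTI [set _ | _]); exact: emeasurable_fun_lt.
(* The difference is taken only where [q < g]; there [q] is finite, so no difference of infinities
   occurs. *)
pose del := mix D (fun x => g x - q x)%E (cst 0%E).
have mdel : measurable_fun setT del.
  by apply: measurable_mix => //; exact: emeasurable_funB.
have del0 x : (0 <= del x)%E.
  rewrite /del /mix; case: ifPn => // /set_mem Dx; rewrite sube_ge0 ?qg//.
  by apply/orP; left; rewrite ge0_fin_numE//; exact: lt_le_trans Dx (leey _).
have gE x : g x = (q x + del x)%E.
  rewrite /del /mix; case: ifPn => [/set_mem Dx|/negP nD].
    by rewrite addeC subeK// ge0_fin_numE//; exact: lt_le_trans Dx (leey _).
  rewrite adde0; apply/eqP; rewrite eq_le qg andbT leNgt; apply/negP => Dx.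
  by apply: nD; exact: mem_set.
have Idel : (\int[mu]_x del x)%E = 0%E.
  have Iq0 : (0 <= \int[mu]_x q x)%E by exact: integral_ge0.
  have Idel0 : (0 <= \int[mu]_x del x)%E by exact: integral_ge0.
  have fq : (\int[mu]_x q x)%E \is a fin_num by rewrite ge0_fin_numE.
  apply/eqP; rewrite eq_le Idel0 andbT -(leeD2lE _ _ fq) adde0.
  rewrite -ge0_integralD//; apply: le_trans Igq.
  by under [leRHS]eq_integral do rewrite gE.
have : (\int[mu]_x `|del x| = 0)%E.
  by under eq_integral do rewrite gee0_abs//.
move=> /(ae_eq_integral_abs _ measurableT mdel); apply: filterS => x /(_ I) dx.
by rewrite [RHS]gE dx adde0.
Qed.

Lemma exists_least_ae_ug E f g0 : Lpb g0 -> ae_ug E f g0 ->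
  exists g, [/\ Lpb g, ae_ug E f g &
    forall h, Lpb h -> ae_ug E f h -> {ae mu, forall x, (g x <= h x)%E}].
Proof.
move=> L0 ug0.
pose energy g : \bar R := (\int[mu]_x poweR (g x) p)%E.
have energy_ge0 g : (0 <= energy g)%E by apply: integral_ge0 => x _; exact: poweR_ge0.
pose S := [set energy h | h in [set h | Lpb h /\ ae_ug E f h]].
pose m := ereal_inf S.
have m_ge0 : (0 <= m)%E by apply: le_ereal_inf_tmp => _ [h _ <-].
have mfin : m \is a fin_num.
  rewrite ge0_fin_numE//; have [_ _ I0] := L0; apply: le_lt_trans I0.
  by apply: ereal_inf_lbound; exists g0.
have e0 n : 0 < n.+1%:R^-1 :> R by rewrite invr_gt0.
have /choice[h Hh] n : exists h, [/\ Lpb h, ae_ug E f h & (energy h < m + n.+1%:R^-1%:E)%E].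
  by have [_ [h [Lh uh] <-] hm] := lb_ereal_inf_adherent (e0 n) mfin; exists h.
(* Running minima of the minimizing sequence: they remain competitors by [ae_ug_min] and lie below
   [h n]. *)
pose k := fix k n x := if n is n'.+1 then Order.min (k n' x) (h n x) else h 0%N x.
have kS n x : k n.+1 x = Order.min (k n x) (h n.+1 x) by [].
have Lmin g g' : Lpb g -> Lpb g' -> Lpb (fun x => Order.min (g x) (g' x)).
  move=> Lg [bg' g'0 _]; have [bg gg0 _] := Lg; apply: (Lp_borel_le p0 _ _ _ Lg).
  - exact: measurable_mine.
  - by move=> x; rewrite le_min gg0 g'0.
  - by move=> x; rewrite ge_min lexx.
have Hk n : Lpb (k n) /\ ae_ug E f (k n).
  elim: n => [|n [Lk uk]]; first by have [] := Hh 0%N.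
  have [Lh uh _] := Hh n.+1; split; first exact: Lmin.
  exact: ae_ug_min.
have k_ge0 n x : (0 <= k n x)%E by have [[]] := Hk n.
have kh n x : (k n x <= h n x)%E by case: n => [//|n]; rewrite kS ge_min lexx orbT.
have kdec x : nonincreasing_seq (k ^~ x).
  by apply/nonincreasing_seqP => n; rewrite kS ge_min lexx.
have klim x := ereal_nonincreasing_cvgn (kdec x).
pose g x := ereal_inf (range (k ^~ x)).
have gk n x : (g x <= k n x)%E by apply: ereal_inf_lbound; exists n.
have g_ge0 x : (0 <= g x)%E by apply: le_ereal_inf_tmp => _ [n _ <-].
have Lg : Lpb g.
  apply: (Lp_borel_le p0 _ g_ge0 (gk 0%N) (Hk 0%N).1).
  have bk n : borel_fun dist (k n) by have [[]] := Hk n.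
  pose B := g_sigma_algebraType [set A | dopen dist A].
  exact: (@emeasurable_fun_cvg _ B R setT k g bk (fun x _ => klim x)).
have ugg : ae_ug E f g.
  apply: (@ae_ug_lim _ _ k) => //.
  - by move=> n; exact: (Hk n).1.
  - by move=> n x; exact: kdec.
  - by move=> n; exact: (Hk n).2.
have Igm : (energy g <= m)%E.
  apply/lee_addgt0Pr => e ep; pose n := Num.bound e^-1.
  have [_ _ hn] := Hh n; apply: (@le_trans _ _ (energy (h n))).
    apply: ge0_le_lower_integral => x _; first exact: poweR_ge0.
    by apply: ge0_le_poweR => //; [exact: ltW|exact: le_trans (gk n x) (kh n x)].
  apply: le_trans (ltW hn) _; apply: leeD2l; rewrite lee_fin ltW//.
  exact: invr_bound_lt.
exists g; split => // h' Lh' uh'.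
(* The minimum [q] of [g] and [h'] is a competitor, so its energy is at least [m], hence at least
   that of [g]; since [q <= g], the two agree almost everywhere. *)
have Lq := Lmin _ _ Lg Lh'; have uq := ae_ug_min Lg Lh' ugg uh'.
set q := (fun x => _) in Lq uq.
have [bq q_ge0 Iq] := Lq; have [bg _ Ig] := Lg.
have qg x : (q x <= g x)%E by rewrite /q ge_min lexx.
have : {ae mu, forall x, poweR (q x) p = poweR (g x) p}.
  apply: ae_eq_of_integral_le => //.
  - by apply: measurable_fun_poweR; exact: (borel_fun_measurable mu_borel bq).
  - by apply: measurable_fun_poweR; exact: (borel_fun_measurable mu_borel bg).
  - by move=> x; exact: poweR_ge0.
  - by move=> x; apply: ge0_le_poweR => //; exact: ltW.
  - by apply: le_trans Igm _; apply: ereal_inf_lbound; exists q.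
have pn0 : p != 0 by rewrite gt_eqF.
apply: filterS => x qgx; rewrite -(poweRK pn0 (g_ge0 x)) -qgx poweRK//.
by rewrite /q ge_min lexx orbT.
Qed.

End fine_gradients.

(** * Minimal gradients, restriction and gluing over a quasicovering *)

Section gluing.
Context {R : realType} {d : measure_display} {T : measurableType d}
  (dist : T -> T -> R) (mu : {measure set T -> \bar R}) (p : R).
Hypothesis p0 : 0 < p.
Hypothesis dist_metric : is_metric dist.
Hypothesis mu_borel : complete_borel_measure dist mu.
Implicit Types (E U V : set T) (c : curve R T) (f g h rho u : T -> \bar R).

Local Notation Lpb := (Lp_borel dist mu p).
Local Notation aec := (ae_curve dist mu p).
Local Notation ae_ug := (ae_ug dist mu p).

(** The least gradient is compared with Borel functions only; any other p-weak upper gradient is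
    replaced by a Borel majorant that equals it almost everywhere in E. *)
Lemma exists_min_pweak_ug E f g : measurable E -> Lpb g -> ae_ug E f g ->
  exists h, min_pweak_ug dist mu p E f h.
Proof.
move=> mE Lg ugg.
have [h [Lh ugh hmin]] := exists_least_ae_ug p0 dist_metric mu_borel Lg ugg.
have [bh h0 _] := Lh; have [mEh Ih] := Lp_borel_Lp_on mu_borel mE Lh.
exists h; split.
  apply: (ae_ug_pweak_ug p0 dist_metric mu_borel mE mEh _ bh h0 _ ugh) => [x _//|].
  by apply: aeW.
split=> // k [mk [k0 [G HG]]] Lk.
have [k' [Lk' kk' aek]] := Lp_on_majorant p0 mu_borel mE Lk k0.
have [bk' k'0 _] := Lk'.
have ugk' : ae_ug E f k'.
  apply: (pweak_ug_ae_ug p0 dist_metric mu_borel mE _ bk' k'0 (aeW _ kk')).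
  by split => //; split => //; exists G.
by have := hmin _ Lk' ugk'; apply: filterS2 aek => x kx hx Ex; rewrite -kx.
Qed.

(** Through [ae_ug] the exceptional family is controlled on the whole space, and this control passes
    to subsets. *)
Lemma pweak_ugS E V f h : measurable E -> measurable V -> V `<=` E ->
  pweak_ug dist mu p E f h -> Lp_on mu p E h ->
  pweak_ug dist mu p V f h /\ Lp_on mu p V h.
Proof.
move=> mE mV VE pw Lh; have [mh [h0 _]] := pw.
have mVh : measurable_fun V h by exact: measurable_funS mh.
split; last first.
  split => //; have [_ Ih] := Lh; apply: le_lt_trans Ih.
  apply: ge0_subset_integral => //.
  - by apply: measurable_fun_poweR; exact: measurableT_comp.
  - by move=> x _; exact: poweR_ge0.
have [k [Lk hk kh]] := Lp_on_majorant p0 mu_borel mE Lh h0; have [bk k0 _] := Lk.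
have ugk := pweak_ug_ae_ug p0 dist_metric mu_borel mE pw bk k0 (aeW _ hk).
apply: (ae_ug_pweak_ug p0 dist_metric mu_borel mV mVh _ bk k0 _ (ae_ugS VE ugk)).
  by move=> x /VE; exact: h0.
by apply: filterS kh => x khx /VE /khx ->.
Qed.

Lemma ae_curve_countable (B : set (set T)) (P : set T -> curve R T -> Prop) :
  countable B -> (forall V, B V -> aec (P V)) -> aec (fun c => forall V, B V -> P V c).
Proof.
move=> /countable_injP[i iinj] aP.
have : aec (fun c => forall n V, B V -> i V = n -> P V c).
  apply: ae_curve_all => // n.
  have [[V BV iV]|nV] := pselect (exists2 V, B V & i V = n).
    apply: ae_curveS (aP V BV) => c _ PVc W BW iW.
    by rewrite (iinj W V) ?inE// iW iV.
  by apply: ae_curveW => // c _ V BV iV; exfalso; apply: nV; exists V.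
by apply: ae_curveS => c _ H V BV; exact: (H (i V)).
Qed.

Lemma ae_countable (B : set (set T)) (P : set T -> T -> Prop) :
  countable B -> (forall V, B V -> {ae mu, forall x, P V x}) ->
  {ae mu, forall x, forall V, B V -> P V x}.
Proof.
move=> /countable_injP[i iinj] aP.
have : {ae mu, forall x, forall n V, B V -> i V = n -> P V x}.
  apply: ae_foralln => n.
  have [[V BV iV]|nV] := pselect (exists2 V, B V & i V = n).
    apply: filterS (aP V BV) => x PVx W BW iW.
    by rewrite (iinj W V) ?inE// iW iV.
  by apply: aeW => x V BV iV; exfalso; apply: nV; exists V.
by apply: filterS => x H V BV; exact: (H (i V)).
Qed.

(* Almost every curve in U is covered by the relatively open preimages of the
   members of B, so that the inequality on short subcurves propagates. *)
Lemma ae_ug_glue U B u h : quasicovering dist mu p U B -> Lpb h ->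
  (forall V, B V -> ae_ug V u h) -> ae_ug U u h.
Proof.
move=> [cB qB BU CU] [bh h0 _] ugB.
have A1 : aec (fun c => forall V, B V -> forall t, 0 <= t -> t <= c.2 -> V (c.1 t) ->
    exists2 e, 0 < e & forall s, 0 <= s -> s <= c.2 -> `|s - t| < e -> V (c.1 s)).
  by apply: ae_curve_countable => // V BV; apply: quasiopen_path_open => //; exact: qB.
(* One exceptional family serves all subcurves at once, including subcurves in V of a curve that
   leaves V. *)
have A2 : aec (fun c => forall V, B V -> forall a b, 0 <= a -> a < b -> b <= c.2 ->
    curve_in dist V (subcurve c a b) -> ug_ineq u h (subcurve c a b)).
  by apply: ae_curve_countable => // V BV; exact: (ae_curve_sub dist_metric (ugB V BV)).
have A3 := ae_curve_avoids_null p0 dist_metric mu_borel CU.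
have A12 := ae_curve_and p0 dist_metric mu_borel A1 A2.
apply: ae_curveS (ae_curve_and p0 dist_metric mu_borel A12 A3) => c cT [[c1 c2] c3] cU.
have l0 : 0 < c.2 by case: cU.
have mhc := measurable_fun_cpath dist_metric cU bh.
suff : (ug_lhs (u (cpath c 0)) (u (cpath c c.2)) <=
    \int[lebesgue_measure]_(t in `[0%R, c.2]) h (cpath c t))%E.
  by rewrite /ug_ineq line_int_cpath !cpath_id// ltW.
pose P a b := (ug_lhs (u (cpath c a)) (u (cpath c b)) <=
    \int[lebesgue_measure]_(t in `[a, b]) h (cpath c t))%E.
apply: (@real_interval_chain _ P) => // [a b e a0 ab be el Pab Pbe|t t0 tl].
  by apply: (@ug_lhs_chain _ (u \o cpath c) (h \o cpath c) a b e mhc) => //;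
    [move=> r /=|exact: ltW|exact: ltW].
have Ut : U (c.1 t) by case: cU => _ [_]; exact.
have [V BV Vt] : (\bigcup_(V in B) V) (c.1 t).
  by apply: contrapT => nB; exact: (c3 t t0 tl).
have [e e0 He] := c1 V BV t t0 tl Vt.
exists e => // a b a0 ab bl ta bt.
(* All parameters of this subcurve are within [e] of [t], so it stays in V. *)
have sc : curve_in dist V (subcurve c a b).
  apply: (curve_in_of_points (subcurve_in cT a0 ab bl)) => s /= s0 sb.
  by apply: He; [lra|lra|rewrite ltr_norml; apply/andP; split; lra].
have := c2 V BV a b a0 ab bl sc.
rewrite /ug_ineq (line_int_subcurve dist_metric cT bh h0 a0 bl)/= addr0 subrKC.
by rewrite /P -!(cpath_id (c := c))//; lra.
Qed.

(** On each member the Borel majorant of [hg] dominates a minimal gradient almost everywhere;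
    [ae_ug_glue] joins the resulting inequalities. *)
Lemma pfine_ug_ae_ug U u hg : measurable U -> Lp_on mu p U hg ->
  pfine_ug dist mu p U u hg ->
  exists h, [/\ Lpb h, ae_ug U u h & {ae mu, forall x, U x -> h x = hg x}].
Proof.
move=> mU Lhg [hg0 [B [qB HB]]]; have [cB qoB BU CU] := qB.
have [h [Lh hgh aeh]] := Lp_on_majorant p0 mu_borel mU Lhg hg0.
have [bh h0 _] := Lh.
exists h; split => //; apply: ae_ug_glue qB Lh _ => V BV.
have [_ [g [[pg _] hgg]]] := HB V BV.
have mV := quasiopen_measurable p0 mu_borel (qoB V BV).
apply: (pweak_ug_ae_ug p0 dist_metric mu_borel mV pg bh h0).
apply: filterS hgg => x hggx Vx; rewrite -hggx//; apply: hgh.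
by apply: BU; exists V.
Qed.

(** * Empty exceptional sets and the energy of Newtonian functions *)

(** The test function 0 shows it. The use is the quasicovering with the single member U, whose
    exceptional set is empty. *)
Lemma Cp_set0 : Cp dist mu p set0 = 0%E.
Proof.
have ug0 : upper_gradient dist setT (cst 0%E) (cst 0%E : T -> \bar R).
  split; first by apply: borel_fun_on; exact: measurable_cst.
  split; first by move=> x _.
  move=> c _; rewrite /ug_ineq /ug_lhs /cst sube0 abse0.
  by apply: integral_ge0.
have int0 : (\int[mu]_(x in setT) poweR 0 p)%E = 0%E.
  by rewrite poweR0r ?gt_eqF// integral0.
have energy_ge0 v : (0 <= N1p_energy dist mu p setT v)%E.
  apply: adde_ge0; first by apply: integral_ge0 => x _; exact: poweR_ge0.
  by apply: le_ereal_inf_tmp => _ [g _ <-]; apply: integral_ge0 => x _; exact: poweR_ge0.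
have energy0 : (N1p_energy dist mu p setT (cst 0%E) <= 0)%E.
  rewrite /N1p_energy; under eq_integral do rewrite /cst abse0.
  rewrite int0 add0e.
  by apply: ereal_inf_lbound; exists (cst 0%E).
apply/eqP; rewrite eq_le; apply/andP; split; last first.
  by apply: le_ereal_inf_tmp => _ [v _ <-].
apply: (le_trans _ energy0); apply: ereal_inf_lbound; exists (cst 0%E) => //; split => //.
by split; [exact: measurable_cst|exact: (le_lt_trans energy0 (ltry 0))].
Qed.

Lemma N1p_upper_gradient E u : N1p dist mu p E u ->
  Lp_on mu p E u /\
  exists2 g, upper_gradient dist E u g & (\int[mu]_(x in E) poweR (g x) p < +oo)%E.
Proof.
move=> [mu_ Eu]; rewrite /N1p_energy in Eu.
have inf0 : (0 <= ereal_inf [set (\int[mu]_(x in E) poweR (g x) p)%E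
    | g in upper_gradient dist E u])%E.
  by apply: le_ereal_inf_tmp => _ [g _ <-]; apply: integral_ge0 => x _; exact: poweR_ge0.
have int0 : (0 <= \int[mu]_(x in E) poweR `|u x| p)%E.
  by apply: integral_ge0 => x _; exact: poweR_ge0.
split; first by split => //; exact: le_lt_trans (leeDl _ inf0) Eu.
by have /ereal_inf_lt[_ [g ug <-] Ig] := le_lt_trans (leeDr _ int0) Eu; exists g.
Qed.

Lemma upper_gradient_N1p E u g : Lp_on mu p E u -> upper_gradient dist E u g ->
  (\int[mu]_(x in E) poweR (g x) p < +oo)%E -> N1p dist mu p E u.
Proof.
move=> [mu_ Iu] ug Ig; split => //; apply: lte_add_pinfty => //.
by apply: le_lt_trans Ig; apply: ereal_inf_lbound; exists g.
Qed.

End gluing.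

(** * Newtonian functions on U characterized by fine upper gradients *)

Unset Implicit Arguments.

Theorem theorem7p4 (R : realType) (d : measure_display) (T : measurableType d)
  (dist : T -> T -> R) (mu : {measure set T -> \bar R}) (p : R)
  (U : set T) (u : T -> \bar R) :
  standing dist mu p ->
  quasiopen dist mu p U ->
  (N1p dist mu p U u <->
     Lp_on mu p U u /\ exists hg, pfine_ug dist mu p U u hg /\ Lp_on mu p U hg) /\
  (forall hg, N1p dist mu p U u -> pfine_ug dist mu p U u hg -> Lp_on mu p U hg ->
     exists g, min_pweak_ug dist mu p U u g /\ {ae mu, forall x, U x -> hg x = g x}).
Proof.
move=> [p1 dist_metric _ mu_borel _] qU; have p0 : 0 < p by exact: lt_trans p1.
have mU := quasiopen_measurable p0 mu_borel qU.
split; last first.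
  (* [hg] itself is the minimal gradient in U: gluing yields the inequality, and the members of the
     quasicovering yield minimality. *)
  move=> hg _ pf Lhg; exists hg; split; last by apply: aeW.
  have [h [Lh ugh hhg]] := pfine_ug_ae_ug p0 dist_metric mu_borel mU Lhg pf.
  have [bh h0 _] := Lh; have [hg0 [B [[cB qoB BU CU] HB]]] := pf.
  have [mhg _] := Lhg.
  split.
    apply: (ae_ug_pweak_ug p0 dist_metric mu_borel mU mhg hg0 bh h0 _ ugh).
    by apply: filterS hhg => x hx Ux; rewrite hx.
  (* A competitor on U restricts to a competitor on each V, where it lies above the local minimal
     gradient. *)
  split => // k pk Lk.
  have HV V : B V -> {ae mu, forall x, V x -> (hg x <= k x)%E}.
    move=> BV; have [_ [g [[_ [_ gmin]] hgg]]] := HB V BV.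
    have mV := quasiopen_measurable p0 mu_borel (qoB V BV).
    have VU : V `<=` U by move=> x Vx; apply: BU; exists V.
    have [pkV LkV] := pweak_ugS p0 dist_metric mu_borel mU mV VU pk Lk.
    by have := gmin k pkV LkV; apply: filterS2 hgg => x hgx gk Vx; rewrite hgx// gk.
  have aeB := ae_countable cB HV.
  (* What the covering misses has zero capacity, hence zero measure. *)
  have aeU : {ae mu, forall x, ~ (U `\` \bigcup_(V in B) V) x}.
    have : mu.-negligible (U `\` \bigcup_(V in B) V).
      exact: (Cp_negligible p0 mu_borel CU).
    by apply: negligibleS => x /= /contrapT.
  apply: filterS2 aeU aeB => x nx HBx Ux.
  have [V BV Vx] : (\bigcup_(V in B) V) x by apply: contrapT => nB; apply: nx.
  exact: (HBx V BV Vx).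
split=> [Nu|[Lu [hg [pf Lhg]]]]; last first.
  (* The glued inequality holds along almost every curve; enlarging the function gives a true upper
     gradient of finite energy. *)
  have [h [Lh ugh _]] := pfine_ug_ae_ug p0 dist_metric mu_borel mU Lhg pf.
  have [g Lg ug] := ae_ug_upper_gradient mu_borel Lh ugh.
  apply: upper_gradient_N1p Lu ug _; have [bg g0 Ig] := Lg.
  apply: le_lt_trans Ig; apply: le_integralT => //.
  exact: (borel_fun_measurable mu_borel bg).
have [Lu [g ug Ig]] := N1p_upper_gradient Nu; split => //.
have [bg [g0 _]] := ug.
have LgU : Lp_on mu p U g.
  split; first exact: (borel_on_measurable mu_borel mU bg).
  apply: le_lt_trans Ig; apply: ge0_le_lower_integral => x Ux; first exact: poweR_ge0.
  by rewrite gee0_abs// g0.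
(* A Borel majorant on the whole space makes the upper gradient in U a starting point for the
   minimization. *)
have [k [Lk gk _]] := Lp_on_majorant p0 mu_borel mU LgU g0.
have ugk := upper_gradient_ae_ug mu p0 ug gk.
have [hg Mhg] := exists_min_pweak_ug p0 dist_metric mu_borel mU Lk ugk.
have [[mhg [hg0 _]] [Lhg _]] := Mhg.
exists hg; split => //; split => //.
exists [set U]; split.
  split => //.
  - by move=> V ->.
  - by rewrite bigcup_set1.
  - by rewrite bigcup_set1 setDv Cp_set0.
move=> V ->; split.
  by split; [have [] := Lu|exists g].
by exists hg; split => //; apply: aeW.
Qed.
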